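(* Let $n$ be a positive integer and let $H$ be a group containing $\mathrm{Aut}(F_n)$. Then the following hold: (a) The group $H$ contains the group $\mathrm{Aut}(F_s)$ for every positive integer $s\leqslant n$. (b) If $n\geqslant 2$, then the group $H$ contains the group $F_m$ for every positive integer $m$ and is nonamenable. (c) If $n\geqslant 3$, then the group $H$ is nonlinear. (d) If $n\geqslant 3$, then the group $H$ contains the braid group $B_n$ on $n$ strands.
   Context: $F_m$ denotes a free group of rank $m$. A group $H$ contains a group $K$ if there is an injective homomorphism $K\hookrightarrow H$. Amenability is that of abstract (discrete) groups. A group is nonlinear if it is not isomorphic to a subgroup of $\mathrm{GL}_d(K)$ for any positive integer $d$ and any field $K$. *)

(* Defs.v *)
From HB Require Import structures.
From mathcomp Require Import all_boot all_order all_algebra.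
From mathcomp Require Import boolp classical_sets reals.

Set Implicit Arguments.
Unset Strict Implicit.
Unset Printing Implicit Defensive.

Local Open Scope group_scope.

Definition contains (H K : groupType) : Prop :=
  exists f : {multiplicative K -> H}, injective f.

Section FreeGroup.
Variable I : choiceType.
Implicit Types (a b : I * bool) (s t : seq (I * bool)).

(* The letter (i, false) stands for the generator i and (i, true) for its
   inverse. *)
Definition flip_letter a : I * bool := (a.1, ~~ a.2).

Definition reduced s : bool := sorted (fun a b => b != flip_letter a) s.

Definition push_letter a s : seq (I * bool) :=
  if s is b :: s' then if b == flip_letter a then s' else a :: s else [:: a].

Definition reduce s : seq (I * bool) := foldr push_letter [::] s.

Definition inv_word s : seq (I * bool) := rev (map flip_letter s).

Record free_group := FreeGroup {
  word_of :> seq (I * bool);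
  _ : reduced word_of }.

HB.instance Definition _ := [isSub for word_of].
HB.instance Definition _ := [Choice of free_group by <:].

Lemma flip_letterK : involutive flip_letter.
Proof. by case=> i b; rewrite /flip_letter /= negbK. Qed.

Lemma push_letter_reduced a s : reduced s -> reduced (push_letter a s).
Proof.
case: s => [|b s] //= red_s; case: ifPn => [_|ne_b] /=.
  exact: path_sorted red_s.
by rewrite ne_b.
Qed.

Lemma foldr_push_reduced s t : reduced t -> reduced (foldr push_letter t s).
Proof. by move=> red_t; elim: s => //= a s; apply: push_letter_reduced. Qed.

Lemma reduce_reduced s : reduced (reduce s).
Proof. exact: foldr_push_reduced. Qed.

Lemma push_letterK a s :
  reduced s -> push_letter (flip_letter a) (push_letter a s) = s.
Proof.
case: s => [|b s] /=; first by rewrite flip_letterK eqxx.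
case: (b =P flip_letter a) => [-> | ne_b] /=; last by rewrite flip_letterK eqxx.
by case: s => [|c s] //= /andP[/negPf-> _].
Qed.

Lemma reduce_id s : reduced s -> reduce s = s.
Proof.
elim: s => //= a s IHs red_s; rewrite IHs; last exact: path_sorted red_s.
by case: s red_s {IHs} => //= b s /andP[/negPf-> _].
Qed.

Lemma foldr_push_push a s t : reduced s -> reduced t ->
  foldr push_letter t (push_letter a s) =
  push_letter a (foldr push_letter t s).
Proof.
case: s => [|b s] //= red_s red_t; case: eqP => //= ->.
by rewrite -{1}[a]flip_letterK push_letterK // foldr_push_reduced.
Qed.

Lemma foldr_push_reduce s t : reduced t ->
  foldr push_letter t (reduce s) = foldr push_letter t s.
Proof.
move=> red_t; elim: s => //= a s <-.
exact: foldr_push_push (reduce_reduced s) red_t.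
Qed.

Lemma reduce_catl s t : reduce (reduce s ++ t) = reduce (s ++ t).
Proof. by rewrite /reduce !foldr_cat foldr_push_reduce ?reduce_reduced. Qed.

Lemma reduce_catr s t : reduce (s ++ reduce t) = reduce (s ++ t).
Proof.
by rewrite /reduce !foldr_cat; congr foldr; apply/reduce_id/reduce_reduced.
Qed.

Lemma inv_wordK : involutive inv_word.
Proof. by move=> s; rewrite /inv_word map_rev revK (mapK flip_letterK). Qed.

Lemma inv_word_reduced s : reduced s -> reduced (inv_word s).
Proof.
rewrite /reduced /inv_word rev_sorted; case: s => //= a s.
rewrite path_map; apply: sub_path => b c /=; apply: contra => /eqP ->.
by rewrite flip_letterK.
Qed.

Lemma reduce_inv_word s : reduce (inv_word s ++ s) = [::].
Proof.
elim: s => //= a s IHs.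
rewrite {1}/inv_word /= rev_cons cat_rcons /reduce foldr_cat /=.
by rewrite push_letterK ?reduce_reduced // -foldr_cat.
Qed.

Lemma free_group_reduced (x : free_group) : reduced x.
Proof. by case: x. Qed.

Definition free_one : free_group := @FreeGroup [::] isT.
Definition free_mul (x y : free_group) : free_group :=
  FreeGroup (reduce_reduced (x ++ y)).
Definition free_inv (x : free_group) : free_group :=
  FreeGroup (inv_word_reduced (free_group_reduced x)).
Definition free_gen (i : I) : free_group := @FreeGroup [:: (i, false)] isT.

Fact free_mulA : associative free_mul.
Proof.
by move=> x y z; apply/val_inj; rewrite /= reduce_catl reduce_catr catA.
Qed.
Fact free_mul1 : left_id free_one free_mul.
Proof. by move=> x; apply/val_inj; rewrite /= reduce_id ?free_group_reduced. Qed.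
Fact free_mulx1 : right_id free_one free_mul.
Proof.
by move=> x; apply/val_inj; rewrite /= cats0 reduce_id ?free_group_reduced.
Qed.
Fact free_mulV : left_inverse free_one free_inv free_mul.
Proof. by move=> x; apply/val_inj; exact: reduce_inv_word. Qed.
Fact free_mulxV : right_inverse free_one free_inv free_mul.
Proof.
move=> x; apply/val_inj; rewrite /= -{1}[word_of x]inv_wordK.
exact: reduce_inv_word.
Qed.

HB.instance Definition _ := isGroup.Build free_group
  free_mulA free_mul1 free_mulx1 free_mulV free_mulxV.

End FreeGroup.

Section Automorphisms.
Variable G : groupType.

Definition is_aut (f : G -> G) : bool :=
  `[< {morph f : x y / x * y} /\ bijective f >].

Record aut := MkAut { aut_fun :> G -> G; _ : is_aut aut_fun }.

HB.instance Definition _ := [isSub for aut_fun].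
HB.instance Definition _ := [Choice of aut by <:].

Lemma autP (f : aut) : {morph f : x y / x * y} /\ bijective f.
Proof. by case: f => f fA; apply/asboolP. Qed.

HB.instance Definition _ (f : aut) := isMultiplicative.Build G G f (autP f).1.

Fact is_aut_id : is_aut id.
Proof. by apply/asboolP; split=> //; exists id. Qed.

Fact is_aut_comp (f g : aut) : is_aut (f \o g).
Proof.
have [[fM fbij] [gM gbij]] := (autP f, autP g).
by apply/asboolP; split; [move=> x y; rewrite /= gM fM | exact: bij_comp].
Qed.

Fact aut_has_inv (f : aut) : exists g : aut, cancel f g /\ cancel g f.
Proof.
have [fM [g fK gK]] := autP f.
have gM : {morph g : x y / x * y}.
  by move=> x y; apply: (can_inj fK); rewrite fM !gK.
by exists (MkAut (asboolT (conj gM (Bijective gK fK)))).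
Qed.

Definition aut_one : aut := MkAut is_aut_id.
Definition aut_mul (f g : aut) : aut := MkAut (is_aut_comp f g).
Definition aut_inv (f : aut) : aut := sval (cid (aut_has_inv f)).

Fact aut_mulA : associative aut_mul.
Proof. by move=> f g h; apply/val_inj. Qed.
Fact aut_mul1 : left_id aut_one aut_mul.
Proof. by move=> f; apply/val_inj. Qed.
Fact aut_mulx1 : right_id aut_one aut_mul.
Proof. by move=> f; apply/val_inj. Qed.
Fact aut_mulV : left_inverse aut_one aut_inv aut_mul.
Proof.
move=> f; apply/val_inj/funext => x /=; rewrite /aut_inv.
by case: cid => g [fK _] /=.
Qed.
Fact aut_mulxV : right_inverse aut_one aut_inv aut_mul.
Proof.
move=> f; apply/val_inj/funext => x /=; rewrite /aut_inv.
by case: cid => g [_ gK] /=.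
Qed.

HB.instance Definition _ := isGroup.Build aut
  aut_mulA aut_mul1 aut_mulx1 aut_mulV aut_mulxV.

End Automorphisms.

Section NormalClosure.
Variables (G : groupType) (R : set G).

Inductive normal_closure : G -> Prop :=
| NClosureRel x : R x -> normal_closure x
| NClosure1 : normal_closure 1
| NClosureM x y :
    normal_closure x -> normal_closure y -> normal_closure (x * y)
| NClosureV x : normal_closure x -> normal_closure x^-1
| NClosureJ x y : normal_closure x -> normal_closure (x ^ y).

Definition nclosure_rel : rel G := fun x y => `[< normal_closure (x^-1 * y) >].

Fact nclosure_rel_refl : reflexive nclosure_rel.
Proof. by move=> x; apply/asboolP; rewrite mulVg; exact: NClosure1. Qed.

Fact nclosure_rel_sym : symmetric nclosure_rel.
Proof.
suff sub x y : nclosure_rel x y -> nclosure_rel y x.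
  by move=> x y; apply/idP/idP; exact: sub.
by move=> /asboolP/NClosureV xy; apply/asboolP; rewrite invgM invgK in xy.
Qed.

Fact nclosure_rel_trans : transitive nclosure_rel.
Proof.
move=> y x z /asboolP xy /asboolP yz; apply/asboolP.
by have := NClosureM xy yz; rewrite -mulgA mulVKg.
Qed.

Canonical nclosure_equiv :=
  EquivRel nclosure_rel nclosure_rel_refl nclosure_rel_sym nclosure_rel_trans.

Local Open Scope quotient_scope.

Definition quot_nclosure := {eq_quot nclosure_equiv}.

HB.instance Definition _ := Choice.on quot_nclosure.
HB.instance Definition _ := EqQuotient.on quot_nclosure.

Definition qn_pi (x : G) : quot_nclosure := \pi_quot_nclosure x.

Lemma qn_piP x y : qn_pi x = qn_pi y <-> normal_closure (x^-1 * y).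
Proof.
by split=> [/eqmodP/asboolP // | xy]; apply/eqmodP/asboolP.
Qed.

Lemma qn_piM x x' y y' :
  qn_pi x = qn_pi x' -> qn_pi y = qn_pi y' -> qn_pi (x * y) = qn_pi (x' * y').
Proof.
rewrite !qn_piP => xx' yy'.
have := NClosureM (NClosureJ y xx') yy'.
by rewrite conjgE invgM !mulgA mulgK.
Qed.

Lemma qn_piV x x' : qn_pi x = qn_pi x' -> qn_pi x^-1 = qn_pi x'^-1.
Proof.
move/esym; rewrite !qn_piP => xx'.
by have := NClosureJ x^-1 xx'; rewrite conjgE !mulgA mulgK.
Qed.

Definition qn_one : quot_nclosure := qn_pi 1.
Definition qn_mul (u v : quot_nclosure) : quot_nclosure :=
  qn_pi (repr u * repr v).
Definition qn_inv (u : quot_nclosure) : quot_nclosure := qn_pi (repr u)^-1.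

Lemma qn_reprK u : qn_pi (repr u) = u.
Proof. exact: reprK. Qed.

Lemma qn_mulE x y : qn_mul (qn_pi x) (qn_pi y) = qn_pi (x * y).
Proof. by apply: qn_piM; rewrite qn_reprK. Qed.

Lemma qn_invE x : qn_inv (qn_pi x) = qn_pi x^-1.
Proof. by apply: qn_piV; rewrite qn_reprK. Qed.

Fact qn_mulA : associative qn_mul.
Proof.
move=> u v w; rewrite -[u]qn_reprK -[v]qn_reprK -[w]qn_reprK.
by rewrite !qn_mulE mulgA.
Qed.
Fact qn_mul1 : left_id qn_one qn_mul.
Proof. by move=> u; rewrite -[u]qn_reprK qn_mulE mul1g. Qed.
Fact qn_mulx1 : right_id qn_one qn_mul.
Proof. by move=> u; rewrite -[u]qn_reprK qn_mulE mulg1. Qed.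
Fact qn_mulV : left_inverse qn_one qn_inv qn_mul.
Proof. by move=> u; rewrite -[u]qn_reprK qn_invE qn_mulE mulVg. Qed.
Fact qn_mulxV : right_inverse qn_one qn_inv qn_mul.
Proof. by move=> u; rewrite -[u]qn_reprK qn_invE qn_mulE mulgV. Qed.

HB.instance Definition _ := isGroup.Build quot_nclosure
  qn_mulA qn_mul1 qn_mulx1 qn_mulV qn_mulxV.

End NormalClosure.

(* Artin's presentation on n strands; the n - 1 standard generators are indexed
   from 0, and each relation u = v is given by the relator u / v. By symmetry
   far commutation is only imposed for i < j. *)
Inductive braid_relator (n : nat) : set (free_group 'I_n.-1) :=
| BraidFar (i j : 'I_n.-1) : (i.+1 < j)%N ->
    braid_relator
      ((free_gen i * free_gen j) / (free_gen j * free_gen i))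
| BraidNear (i j : 'I_n.-1) : i.+1 = j ->
    braid_relator
      ((free_gen i * free_gen j * free_gen i) /
       (free_gen j * free_gen i * free_gen j)).

Definition braid_group (n : nat) : groupType :=
  quot_nclosure (@braid_relator n).

Section GeneralLinear.
Variables (d : nat) (K : fieldType).

(* MathComp's {'GL_d[K]} requires a finite ring, and has size d.-1.+1. *)
Record GL := MkGL { GL_mx :> 'M[K]_d; _ : GL_mx \in unitmx }.

HB.instance Definition _ := [isSub for GL_mx].
HB.instance Definition _ := [Choice of GL by <:].

Lemma GL_unitmx (A : GL) : (A : 'M[K]_d) \in unitmx.
Proof. by case: A. Qed.

Fact GL_one_subproof : (1%:M : 'M[K]_d)%R \in unitmx.
Proof. exact: unitmx1. Qed.
Fact GL_mul_subproof (A B : GL) : (A *m B)%R \in unitmx.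
Proof. by rewrite unitmx_mul !GL_unitmx. Qed.
Fact GL_inv_subproof (A : GL) : invmx A \in unitmx.
Proof. by rewrite unitmx_inv GL_unitmx. Qed.

Definition GL_one : GL := MkGL GL_one_subproof.
Definition GL_mul (A B : GL) : GL := MkGL (GL_mul_subproof A B).
Definition GL_inv (A : GL) : GL := MkGL (GL_inv_subproof A).

Fact GL_mulA : associative GL_mul.
Proof. by move=> A B C; apply/val_inj; exact: mulmxA. Qed.
Fact GL_mul1 : left_id GL_one GL_mul.
Proof. by move=> A; apply/val_inj; exact: mul1mx. Qed.
Fact GL_mulx1 : right_id GL_one GL_mul.
Proof. by move=> A; apply/val_inj; exact: mulmx1. Qed.
Fact GL_mulV : left_inverse GL_one GL_inv GL_mul.
Proof. by move=> A; apply/val_inj; exact: mulVmx (GL_unitmx A). Qed.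
Fact GL_mulxV : right_inverse GL_one GL_inv GL_mul.
Proof. by move=> A; apply/val_inj; exact: mulmxV (GL_unitmx A). Qed.

HB.instance Definition _ := isGroup.Build GL
  GL_mulA GL_mul1 GL_mulx1 GL_mulV GL_mulxV.

End GeneralLinear.

Definition linear_group (H : groupType) : Prop :=
  exists (d : nat) (K : fieldType), (0 < d)%N /\ contains (GL d K) H.

Local Open Scope classical_set_scope.

(* A left-invariant finitely additive probability measure on all subsets of G,
   i.e. amenability of G as a discrete group. *)
Definition amenable (R : realType) (G : groupType) : Prop :=
  exists mu : set G -> R,
    [/\ (forall A, 0 <= mu A)%R,
        mu [set: G] = 1%R,
        (forall A B, A `&` B = set0 -> mu (A `|` B) = mu A + mu B)%R
      & forall (g : G) A, mu [set g * x | x in A] = mu A].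

(* Main.v *)
From HB Require Import structures.
Require Import Defs.
From mathcomp Require Import all_boot all_order all_algebra.
From mathcomp Require Import all_field cyclic.
From mathcomp Require Import boolp classical_sets reals.

(** Write [F_I] for the free group on [I]. An automorphism of [F_I] extends to a
    larger free group, and in rank at least 2 free groups have trivial center, so
    that a free group embeds in its automorphism group by inner automorphisms.
    This gives part (a) ([contains_aut_free]) and, once free groups of all finite
    ranks are found in one of rank 2 ([contains_free]), the free subgroups of
    part (b). A free subgroup on two generators makes [H] nonamenable: after a
    choice of a transversal of its cosets, the words beginning with a given letter
    and those beginning with its inverse have total measure at least 1, and this
    happens for two generators ([free_nonamenable]).

    Part (c) is the theorem of Formanek and Procesi. In the automorphism group of
    the free group on [x], [y] and [z], let [A g] be the inner automorphism of a
    word [g] in [x] and [y], and [L g] the automorphism that fixes [x] and [y] and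
    maps [z] to [g^-1 z]. Then [A] and [L] commute, and the automorphism that
    conjugates [x] and [y] by [z] conjugates [L g] to [A g * L g]
    ([twist_transvection]). In a linear representation, [L g] and [A g * L g] thus
    have the same eigenvalues. Apply to them a logarithm, i.e. a homomorphism from
    the multiplicative group to the rationals, and compare the sums of the
    squares: if [g] is in the commutator subgroup, then the determinant of [L g]
    on the eigenspaces of [A g] is 1, the cross terms cancel ([second_moment]),
    and the sum of the squares of the logarithms of the eigenvalues of [A g] is 0.
    Hence these eigenvalues are roots of unity ([conj_mul_quasi_unipotent]).

    It remains to see that a free group has no faithful representation [a] in
    which all eigenvalues are roots of unity ([free_not_quasi_unipotent]). In
    positive characteristic all matrices [a x] would have finite order. In
    characteristic 0, if [a g] is unipotent then the trace of [a h * a g ^ s] is a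
    polynomial in [s] whose values are sums of boundedly many roots of unity, so
    that it is constant ([trace_unipotent]): this puts [a g - 1] in the radical of
    the trace form, and [a g = 1] if [a] is irreducible ([unipotent_reducible]).
    In general unipotent elements act trivially on the factors of a composition
    series, so that iterated commutators of suitable powers die
    ([iter_commutator_trivial]), which does not happen in a free group.

    Part (d) is the faithfulness of Artin's representation ([artin_hom_inj]), by
    combing. A braid whose action is trivial is a product of a braid on fewer
    strands, of a pure motion of the last strand around the others, and of a
    factor that moves the last strand elsewhere ([combed_mul]). The action detects
    the last factor, and then the pure one, because it records the class of the
    loop that the last strand follows ([pushes_pure]); induction on the number of
    strands concludes. *)

Set Implicit Arguments.
Unset Strict Implicit.
Unset Printing Implicit Defensive.

Local Open Scope group_scope.

(** * Homomorphisms and embeddings *)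

Section Morphisms.
Variables (G H : groupType) (f : {multiplicative G -> H}).

Lemma hom1 : f 1 = 1.
Proof. by apply: (mulgI (f 1)); rewrite -gmulfM !mulg1. Qed.

Lemma homV x : f x^-1 = (f x)^-1.
Proof. by apply/esym/mulg1_eq; rewrite -gmulfM mulgV hom1. Qed.

Lemma homX x n : f (x ^+ n) = f x ^+ n.
Proof. by elim: n => [|n IHn]; rewrite ?hom1 // !expgS gmulfM IHn. Qed.

Lemma homJ x y : f (x ^ y) = f x ^ f y.
Proof. by rewrite !conjgE !gmulfM homV. Qed.

Lemma homR x y : f [~ x, y] = [~ f x, f y].
Proof. by rewrite !commgEl gmulfM homV homJ. Qed.

Lemma hom_inj : (forall x, f x = 1 -> x = 1) -> injective f.
Proof.
by move=> f1 x y fxy; apply/divg1_eq/f1; rewrite gmulfM homV fxy mulgV.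
Qed.

End Morphisms.

Section MkHom.
Variables (G H : groupType) (f : G -> H) (fM : {morph f : x y / x * y}).

Let fhom := isMultiplicative.Build G H f fM.

Definition mkhom : {multiplicative G -> H} := HB.pack f fhom.

End MkHom.

Lemma contains_trans (G H K : groupType) :
  contains K H -> contains H G -> contains K G.
Proof.
move=> [f f_inj] [g g_inj]; exists (f \o g : {multiplicative G -> K}).
exact: inj_comp.
Qed.

(** * Free groups *)

Section FreeHom.
Variables (I : choiceType) (G : groupType).
Implicit Types (f : I -> G) (s t : seq (I * bool)).

Definition letter_val f (a : I * bool) : G := if a.2 then (f a.1)^-1 else f a.1.

Definition word_val f s : G := foldr (fun a x => letter_val f a * x) 1 s.

Lemma letter_val_flip f a : letter_val f (flip_letter a) = (letter_val f a)^-1.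
Proof. by case: a => i []; rewrite /letter_val /= ?invgK. Qed.

Lemma word_val_cat f s t : word_val f (s ++ t) = word_val f s * word_val f t.
Proof. by elim: s => [|a s IHs] /=; rewrite ?mul1g // IHs mulgA. Qed.

Lemma word_val_push f a s :
  word_val f (push_letter a s) = letter_val f a * word_val f s.
Proof.
case: s => [|b s] //=; case: eqP => //= ->.
by rewrite letter_val_flip mulVKg.
Qed.

Lemma word_val_reduce f s : word_val f (reduce s) = word_val f s.
Proof. by elim: s => //= a s <-; rewrite word_val_push. Qed.

Definition free_hom_fun f (x : free_group I) : G := word_val f (word_of x).

Fact free_homM f : {morph free_hom_fun f : x y / x * y}.
Proof.
by move=> x y; rewrite /free_hom_fun /= word_val_reduce word_val_cat.
Qed.

HB.instance Definition _ f :=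
  isMultiplicative.Build (free_group I) G (free_hom_fun f) (free_homM f).

Definition free_hom f : {multiplicative free_group I -> G} := free_hom_fun f.

Lemma free_hom_gen f i : free_hom f (free_gen i) = f i.
Proof. by rewrite /= /free_hom_fun /= mulg1. Qed.

Lemma eq_free_hom (f g : {multiplicative free_group I -> G}) :
  (forall i, f (free_gen i) = g (free_gen i)) -> f =1 g.
Proof.
move=> fg x; case: x => s; elim: s => [|[i b] s IHs] red_s.
  have -> : FreeGroup red_s = 1 :> free_group I by apply/val_inj.
  by rewrite !hom1.
have red_s' : reduced s by exact: path_sorted red_s.
pose a : free_group I := if b then (free_gen i)^-1 else free_gen i.
have -> : FreeGroup red_s = a * FreeGroup red_s'.
  have Da : word_of a = [:: (i, b)] by rewrite /a; case: b {red_s a}.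
  by apply/val_inj => /=; rewrite Da -[LHS]reduce_id.
rewrite !gmulfM IHs; congr (_ * _); rewrite /a.
by case: (b); rewrite ?homV fg.
Qed.

End FreeHom.

Section FreeWords.
Variable I : choiceType.
Implicit Types (x y : free_group I) (a : I * bool).

Lemma word_ofM x y : word_of (x * y) = reduce (word_of x ++ word_of y).
Proof. by []. Qed.

Definition free_letter a : free_group I := @FreeGroup I [:: a] isT.

Lemma free_letterV a : (free_letter a)^-1 = free_letter (flip_letter a).
Proof. by apply/val_inj. Qed.

Lemma word_of_letterM a x : word_of (free_letter a * x) = push_letter a (word_of x).
Proof. by rewrite word_ofM /= reduce_id ?free_group_reduced. Qed.

Lemma letter_val_gen a : letter_val (@free_gen I) a = free_letter a.
Proof. by case: a => i [] //; apply/val_inj. Qed.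

Lemma free_gen_neq1 (i : I) : free_gen i != 1.
Proof. by []. Qed.

Lemma word_val_gen x : word_val (@free_gen I) (word_of x) = x.
Proof.
rewrite -[LHS]/(free_hom (@free_gen I) x).
have id_morph : {morph id : u v / u * v :> free_group I} by [].
rewrite (@eq_free_hom _ _ _ (mkhom id_morph)) // => i.
by rewrite free_hom_gen.
Qed.

End FreeWords.

Definition free_map (I J : choiceType) (f : I -> J) :
    {multiplicative free_group I -> free_group J} :=
  free_hom (fun i => free_gen (f i)).

Lemma free_map_gen (I J : choiceType) (f : I -> J) i :
  free_map f (free_gen i) = free_gen (f i).
Proof. exact: free_hom_gen. Qed.

Lemma free_map_inj (I J : choiceType) (f : I -> J) :
  injective f -> injective (free_map f).
Proof.
move=> f_inj.
pose g j : free_group I :=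
  if pselect (exists i, f i = j) is left ex then free_gen (sval (cid ex)) else 1.
apply: (can_inj (g := free_hom g)) => x.
have id_morph : {morph id : u v / u * v :> free_group I} by [].
rewrite -[LHS]/((free_hom g \o free_map f) x) -[RHS]/(mkhom id_morph x).
apply: eq_free_hom => i; rewrite /= free_map_gen free_hom_gen /g.
by case: pselect => [ex|[]]; [case: cid => j /= /f_inj -> | exists i].
Qed.

Lemma free_ind (I : choiceType) (P : free_group I -> Prop) :
  P 1 -> (forall a x, P x -> P (free_letter a * x)) -> forall x, P x.
Proof.
move=> P1 PM x; rewrite -(word_val_gen x); elim: (word_of x) => //= a s IHs.
by rewrite letter_val_gen; apply: PM.
Qed.

Section ReducedWords.
Variable I : choiceType.
Implicit Types (x y : free_group I) (a b : I * bool) (s t u : seq (I * bool)).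

Lemma reduced_cat_cons a s b t :
  reduced (a :: s ++ b :: t) =
  [&& reduced (a :: s), reduced (b :: t) & b != flip_letter (last a s)].
Proof.
by rewrite /reduced /= cat_path /=; congr (_ && _); rewrite andbC.
Qed.

Lemma word_ofM_reduced x y :
  reduced (word_of x ++ word_of y) -> word_of (x * y) = word_of x ++ word_of y.
Proof. by move=> red_xy; rewrite word_ofM reduce_id. Qed.

Lemma reduced_glue s b t u :
  reduced (s ++ b :: t) -> reduced (b :: t ++ u) -> reduced (s ++ b :: t ++ u).
Proof.
case: s => [|a s] //; rewrite !cat_cons reduced_cat_cons => /and3P[red_s _ ne].
by rewrite reduced_cat_cons red_s ne => ->.
Qed.

Lemma free_eq1 x : (x == 1) = (word_of x == [::]).
Proof. by []. Qed.

(** A letter [c] on another generator than the first letter of a reduced word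
    [w], with the sign that avoids a cancellation at the end of [w], gives two
    reduced words [c w] and [w c] with different first letters. *)
Lemma free_center (i j : I) x :
  i != j -> (forall k, commute x (free_gen k)) -> x = 1.
Proof.
move=> ne_ij xC; apply/eqP; rewrite free_eq1; apply/negPn/negP => x_n1.
have xCl a : commute x (free_letter a).
  by rewrite -letter_val_gen /letter_val; case: a.2; [apply/commuteV|]; exact: xC.
case Dx: (word_of x) x_n1 => [//|a s] _.
have [k ne_ka]: exists k, k != a.1.
  have [Ea|] := eqVneq i a.1; last by exists i.
  by exists j; rewrite -Ea eq_sym.
pose l := last a s; pose c := (k, l.2).
have red_x : reduced (a :: s) by rewrite -Dx free_group_reduced.
have red1 : reduced (word_of (free_letter c) ++ word_of x).
  rewrite Dx -[_ ++ _]/(c :: [::] ++ a :: s) reduced_cat_cons red_x /=.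
  by apply: contra ne_ka => /eqP ->.
have red2 : reduced (word_of x ++ word_of (free_letter c)).
  rewrite Dx cat_cons reduced_cat_cons red_x /= -/l /flip_letter /c.
  by apply/eqP => -[_]; case: (l.2).
have := congr1 (@word_of I) (xCl c); rewrite !word_ofM_reduced // Dx /=.
by case=> Eac; move: ne_ka; rewrite Eac eqxx.
Qed.

End ReducedWords.

(** Substituting nonempty words for letters, without any cancellation between
    consecutive ones, is injective: no nonempty reduced word can vanish. *)
Section Substitution.
Variables (I J : choiceType) (f : I -> free_group J).
Let w (a : I * bool) := word_of (letter_val f a).
Hypothesis w_n0 : forall a, w a != [::].
Hypothesis w_red : forall a b, b != flip_letter a -> reduced (w a ++ w b).

Lemma free_hom_inj : injective (free_hom f).
Proof.
have red_w s : reduced s -> reduced (flatten (map w s)).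
  elim: s => //= a [|b s] /= IHs red_s.
    by rewrite cats0 /w free_group_reduced.
  case/andP: red_s => ne_ba red_s; move: (IHs red_s) (w_red ne_ba) (w_n0 b).
  by case: (w b) => //= c t red_t red_a _; apply: reduced_glue.
have Dw s : reduced s -> word_of (word_val f s) = flatten (map w s).
  elim: s => //= a s IHs red_s; have red_s' := path_sorted red_s.
  by rewrite IHs // reduce_id ?(red_w (a :: s)).
apply: hom_inj => x /(congr1 (@word_of J)); rewrite /= /free_hom_fun.
rewrite Dw ?free_group_reduced // => Dx0; apply/eqP; rewrite free_eq1.
case: (word_of x) Dx0 => //= a s /(congr1 size)/eqP.
by rewrite size_cat /= addn_eq0 => /andP[/nilP wa0]; have := w_n0 a; rewrite wa0.
Qed.

End Substitution.

Lemma word_of_word_val (I : choiceType) (s : seq (I * bool)) :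
  word_of (word_val (@free_gen I) s) = reduce s.
Proof.
elim: s => // a s IHs.
by rewrite [word_val _ _]/= letter_val_gen word_of_letterM IHs.
Qed.

(** Products of these commutators cancel nowhere, as they use disjoint pairs of
    generators; this puts a free group inside the commutator subgroup of
    another. *)
Definition gen_commutator (I : choiceType) (i : I) : free_group (I * bool)%type :=
  [~ free_gen (i, false), free_gen (i, true)].

Lemma gen_commutator_inj (I : choiceType) :
  injective (free_hom (@gen_commutator I)).
Proof.
have Dg i : word_of (@gen_commutator I i) =
    [:: ((i, false), true); ((i, true), true);
        ((i, false), false); ((i, true), false)].
  set s := RHS; suff -> : gen_commutator i = word_val (@free_gen _) s.
    rewrite word_of_word_val reduce_id //.
    by rewrite /reduced /= /flip_letter !xpair_eqE /= !andbF.
  by rewrite /s /= /letter_val /= mulg1.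
have Dw a : word_of (letter_val (@gen_commutator I) a) =
    [:: ((a.1, a.2), true); ((a.1, ~~ a.2), true);
        ((a.1, a.2), false); ((a.1, ~~ a.2), false)].
  by case: a => i []; [exact: (congr1 (@inv_word _) (Dg i)) | exact: Dg].
apply: free_hom_inj => [a|a b ne_ba]; rewrite !Dw //=.
rewrite /reduced /= /flip_letter !xpair_eqE /= !andbT !andbF !eqxx /=.
case: a b ne_ba => [i b1] [j b2]; rewrite /flip_letter /= !xpair_eqE.
by move=> ->; case: b1 b2 => [] [].
Qed.

(** * Automorphisms *)

Section MkAut.
Variables (G : groupType) (f g : {multiplicative G -> G}).

Lemma is_aut_can : cancel f g -> cancel g f -> is_aut f.
Proof.
by move=> fK gK; apply/asboolP; split; [exact: gmulfM | exists g].
Qed.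

Definition mkaut (fK : cancel f g) (gK : cancel g f) : aut G :=
  MkAut (is_aut_can fK gK).

End MkAut.

Section AutTheory.
Variable G : groupType.
Implicit Types f g : aut G.

Lemma autE f g : f =1 g -> f = g.
Proof. by move=> fg; apply/val_inj/funext. Qed.

Lemma autM f g x : (f * g) x = f (g x). Proof. by []. Qed.
Lemma aut1 x : (1 : aut G) x = x. Proof. by []. Qed.

Lemma aut_homM f x y : f (x * y) = f x * f y. Proof. exact: gmulfM. Qed.
Lemma aut_homV f x : f x^-1 = (f x)^-1. Proof. exact: homV. Qed.
Lemma aut_homJ f x y : f (x ^ y) = f x ^ f y. Proof. exact: homJ. Qed.

Lemma autKV f : cancel f^-1 f.
Proof. by move=> x; rewrite -autM mulgV. Qed.

Lemma autK f : cancel f f^-1.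
Proof. by move=> x; rewrite -autM mulVg. Qed.

Section Hom.
Variables (K : groupType) (E : K -> {multiplicative G -> G}).
Hypothesis (E1 : E 1 =1 id) (EM : forall k l x, E (k * l) x = E k (E l x)).

Fact hom_autK k : cancel (E k) (E k^-1).
Proof. by move=> x; rewrite -EM mulVg E1. Qed.

Fact hom_autKV k : cancel (E k^-1) (E k).
Proof. by move=> x; rewrite -EM mulgV E1. Qed.

Definition hom_aut_fun k : aut G := mkaut (hom_autK k) (hom_autKV k).

Fact hom_autM : {morph hom_aut_fun : k l / k * l}.
Proof. by move=> k l; apply: autE => x; rewrite autM /= EM. Qed.

Definition hom_aut : {multiplicative K -> aut G} := mkhom hom_autM.

Lemma hom_autE k x : hom_aut k x = E k x. Proof. by []. Qed.

End Hom.

Fact inn_homM (k : G) : {morph (fun x => x ^ k^-1) : x y / x * y}.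
Proof. by move=> x y; rewrite conjMg. Qed.

Fact inn1 : mkhom (inn_homM 1) =1 id.
Proof. by move=> x; rewrite /= invg1 conjg1. Qed.

Fact innM (k l : G) x :
  mkhom (inn_homM (k * l)) x = mkhom (inn_homM k) (mkhom (inn_homM l) x).
Proof. by rewrite /= invgM conjgM. Qed.

Definition inn : {multiplicative G -> aut G} := hom_aut inn1 innM.

Lemma innE k x : inn k x = k * x * k^-1.
Proof. by rewrite hom_autE /= conjgE invgK mulgA. Qed.

Lemma inn_conj f k : f * inn k * f^-1 = inn (f k).
Proof.
by apply: autE => x; rewrite !autM !innE !gmulfM homV /= autKV.
Qed.

End AutTheory.

Arguments inn {G}.

Section AutFree.
Variable I : choiceType.

Lemma aut_free_eq (f g : aut (free_group I)) :
  (forall i, f (free_gen i) = g (free_gen i)) -> f = g.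
Proof. by move=> fg; apply: autE; apply: eq_free_hom. Qed.

Lemma eq_free_end_id (f : {multiplicative free_group I -> free_group I}) :
  (forall i, f (free_gen i) = free_gen i) -> f =1 id.
Proof.
have id_morph : {morph id : u v / u * v :> free_group I} by [].
by move=> f_id; apply: (@eq_free_hom _ _ f (mkhom id_morph)).
Qed.

Lemma inn_free_inj (i j : I) : i != j -> injective (@inn (free_group I)).
Proof.
move=> ne_ij; apply: hom_inj => x x1; apply: (free_center ne_ij) => k.
by rewrite /commute -[X in _ = X * _](aut1) -x1 innE mulgVK.
Qed.

End AutFree.

(** The extension is the identity on the new generators; that it respects
    composition is seen on generators, since it agrees with the original
    automorphism on the smaller free group. *)
Section AutExtension.
Variables (I J : choiceType) (h : I -> J) (h_inj : injective h).
Local Notation fm := (free_map h).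

Definition aut_ext_gen (f : aut (free_group I)) j : free_group J :=
  if pselect (exists i, h i = j) is left ex then fm (f (free_gen (sval (cid ex))))
  else free_gen j.

Definition aut_ext_fun f : {multiplicative free_group J -> free_group J} :=
  free_hom (aut_ext_gen f).

Lemma aut_ext_gen_in f i : aut_ext_gen f (h i) = fm (f (free_gen i)).
Proof.
rewrite /aut_ext_gen; case: pselect => [ex|[]]; last by exists i.
by case: cid => k /= /h_inj ->.
Qed.

Lemma aut_ext_gen_out f j : ~ (exists i, h i = j) -> aut_ext_gen f j = free_gen j.
Proof. by rewrite /aut_ext_gen; case: pselect. Qed.

Lemma aut_ext_map f x : aut_ext_fun f (fm x) = fm (f x).
Proof.
rewrite -[LHS]/((aut_ext_fun f \o fm) x) -[RHS]/((fm \o f) x).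
apply: eq_free_hom => i /=.
by rewrite [fm _ in LHS]free_map_gen free_hom_gen aut_ext_gen_in.
Qed.

Fact aut_ext1 : aut_ext_fun 1 =1 id.
Proof.
apply: eq_free_end_id => j; rewrite free_hom_gen.
have [[i <-]|out] := pselect (exists i, h i = j).
  by rewrite aut_ext_gen_in free_map_gen.
by rewrite aut_ext_gen_out.
Qed.

Fact aut_extM f g x : aut_ext_fun (f * g) x = aut_ext_fun f (aut_ext_fun g x).
Proof.
rewrite -[RHS]/((aut_ext_fun f \o aut_ext_fun g) x).
apply: eq_free_hom => j /=; rewrite !free_hom_gen.
have [[i <-]|out] := pselect (exists i, h i = j).
  by rewrite !aut_ext_gen_in aut_ext_map.
by rewrite !(aut_ext_gen_out _ out) free_hom_gen aut_ext_gen_out.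
Qed.

Definition aut_ext : {multiplicative aut (free_group I) -> aut (free_group J)} :=
  hom_aut aut_ext1 aut_extM.

Lemma aut_ext_inj : injective aut_ext.
Proof.
move=> f g fg; apply: autE => x; apply: (free_map_inj h_inj).
by rewrite -!aut_ext_map; exact: (congr1 (fun k : aut _ => k (fm x)) fg).
Qed.

Lemma contains_aut_free : contains (aut (free_group J)) (aut (free_group I)).
Proof. by exists aut_ext; exact: aut_ext_inj. Qed.

End AutExtension.

(** The conjugates [p ^ i q p ^- i] of one generator by the powers of another
    are free: in the automorphism group of a free group on [m] generators, let
    [p] act as the cyclic shift of these generators and [q] as the inner
    automorphism of the first one; then [p ^ i q p ^- i] acts as the inner
    automorphism of the generator of index [i]. *)
Section RankTwo.
Variables (J : choiceType) (p q : J) (ne_pq : p != q) (m : nat).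
Local Notation F := (free_group 'I_m.+2).

Definition conj_gens (i : 'I_m.+2) : free_group J :=
  free_gen p ^+ i * free_gen q * free_gen p ^- i.

Fact shiftK : cancel (free_map (@ordS m.+2)) (free_map (@ord_pred m.+2)).
Proof.
move=> x; apply: (eq_free_end_id (f := free_map (@ord_pred _) \o free_map (@ordS _))).
by move=> i; rewrite /= [free_map _ (free_gen i)]free_map_gen free_map_gen ordSK.
Qed.

Fact shiftKV : cancel (free_map (@ord_pred m.+2)) (free_map (@ordS m.+2)).
Proof.
move=> x; apply: (eq_free_end_id (f := free_map (@ordS _) \o free_map (@ord_pred _))).
by move=> i; rewrite /= [free_map _ (free_gen i)]free_map_gen free_map_gen ord_predK.
Qed.

Definition shift : aut F := mkaut shiftK shiftKV.

Lemma shiftX (i : 'I_m.+2) : (shift ^+ i) (free_gen ord0) = free_gen i.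
Proof.
case: i; elim=> [|i IHi] lti /=; first by congr free_gen; apply/val_inj.
rewrite expgS autM (IHi (ltnW lti)) [LHS]free_map_gen; congr free_gen.
by apply/val_inj; rewrite /= modn_small.
Qed.

Lemma conj_gens_inj : injective (free_hom conj_gens).
Proof.
pose act : {multiplicative free_group J -> aut F} :=
  free_hom (fun j => if j == p then shift else inn (free_gen ord0)).
apply: (@inj_compr _ _ _ act).
apply: (@eq_inj _ _ (@inn F)); first by apply: (@inn_free_inj _ ord0 ord_max).
move=> x; rewrite -[RHS]/((act \o free_hom conj_gens) x).
apply: eq_free_hom => i /=; rewrite [free_hom conj_gens _]free_hom_gen.
rewrite !gmulfM homV !homX !free_hom_gen eqxx eq_sym (negPf ne_pq).
by rewrite inn_conj shiftX.
Qed.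

End RankTwo.

Lemma contains_free (J : choiceType) (p q : J) m :
  p != q -> contains (free_group J) (free_group 'I_m).
Proof.
move=> ne_pq; apply: (@contains_trans _ (free_group 'I_m.+2)).
  by exists (free_hom (@conj_gens _ p q m)); exact: conj_gens_inj.
have le_m : (m <= m.+2)%N by rewrite -addn2 leq_addr.
exists (free_map (widen_ord le_m)); apply: free_map_inj.
by move=> i j /(congr1 val) /= /val_inj.
Qed.

(** * Nonamenability *)

Section Nonamenable.
Variables (R : realType) (J : choiceType) (p q : J) (ne_pq : p != q).
Variables (H : groupType) (f : {multiplicative free_group J -> H}).
Hypothesis f_inj : injective f.
Import Order.TTheory GRing.Theory Num.Theory.
Local Open Scope classical_set_scope.
Implicit Types (A B : set H) (h : H) (a b : J * bool).

Let coset_rel h : pred H := fun h' => `[< exists k, h' = f k * h >].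

Let coset_ex h : exists h', coset_rel h h'.
Proof. by exists h; apply/asboolP; exists 1; rewrite hom1 mul1g. Qed.

Let coset_repr h : H := xchoose (coset_ex h).

Let coset_reprP h : exists k, h = f k * coset_repr h.
Proof.
have /asboolP[k Dk] := xchooseP (coset_ex h).
by exists k^-1; rewrite /coset_repr Dk homV mulKg.
Qed.

Let coset_repr_mul k h : coset_repr (f k * h) = coset_repr h.
Proof.
apply: eq_xchoose => h'; apply/asboolP/asboolP => -[l ->].
  by exists (l * k); rewrite gmulfM mulgA.
by exists (l * k^-1); rewrite gmulfM homV mulgA mulgVK.
Qed.

(** The coordinate of [h] along the free subgroup, once a transversal of its
    right cosets is chosen; it turns subsets of the free group into subsets of
    [H], equivariantly. *)
Let coord h : free_group J := sval (cid (coset_reprP h)).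

Let coordP h : h = f (coord h) * coset_repr h.
Proof. exact: svalP (cid (coset_reprP h)). Qed.

Let coordM k h : coord (f k * h) = k * coord h.
Proof.
apply: f_inj; apply: (@mulIg _ (coset_repr h)).
by rewrite gmulfM -mulgA -coordP -(coset_repr_mul k) -coordP.
Qed.

Let starts a : set H := [set h | ohead (word_of (coord h)) = Some a].

Let starts_cover a :
  starts a `|` [set f (free_letter a) * h | h in starts (flip_letter a)] = setT.
Proof.
apply/seteqP; split=> // h _.
have [|not_a] := pselect (starts a h); first by left.
right; exists (f (free_letter (flip_letter a)) * h); last first.
  by rewrite -free_letterV homV mulVKg.
rewrite /starts /= coordM word_of_letterM.
move: not_a; rewrite /starts /=; case: (word_of (coord h)) => //= b s ne_ba.
by case: eqP => // Db; case: ne_ba; rewrite Db flip_letterK.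
Qed.

Let starts_disj a b : a != b -> starts a `&` starts b = set0.
Proof.
move=> ne_ab; apply/seteqP; split=> // h [].
by rewrite /starts /= => -> [Dab]; rewrite Dab eqxx in ne_ab.
Qed.

(** The words beginning with a letter [a], together with the translates by [a] of
    those beginning with its inverse, cover the group. Two generators give four
    disjoint sets of total measure at least 2. *)
Lemma free_nonamenable : ~ amenable R H.
Proof.
case=> mu [mu_ge0 mu1 muU mu_inv].
have mu_le A B : A `<=` B -> (mu A <= mu B)%R.
  move=> sAB; have -> : B = A `|` (B `\` A) by rewrite setDUK.
  by rewrite muU ?setDIK // lerDl.
have mu_leU A B : (mu (A `|` B) <= mu A + mu B)%R.
  have -> : A `|` B = A `|` (B `\` A) by rewrite [RHS]setUC setUDl setDv setD0 setUC.
  by rewrite muU ?setDIK // lerD2l; apply: mu_le; apply: subDsetl.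
have mu_starts a : (1 <= mu (starts a) + mu (starts (flip_letter a)))%R.
  by rewrite -{1}mu1 -(starts_cover a) (le_trans (mu_leU _ _)) // mu_inv.
pose b1 := (p, false); pose b2 := (q, false).
have ne12 : b1 != b2 by rewrite xpair_eqE negb_and ne_pq.
have := mu_le (starts b1 `|` starts (flip_letter b1) `|`
   (starts b2 `|` starts (flip_letter b2))) setT (@subsetT _ _).
rewrite mu1 muU; last first.
  rewrite setIUl !setIUr !starts_disj ?setU0 //;
  by rewrite xpair_eqE ?andbF // negb_and ne_pq.
rewrite !muU ?starts_disj ?xpair_eqE ?andbF //.
have := lerD (mu_starts b1) (mu_starts b2) => le2 /(le_trans le2).
by rewrite gerDl ler10.
Qed.

End Nonamenable.

(** * Braid groups *)

Section QuotientHom.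
Variables (F G : groupType) (R : set F) (f : {multiplicative F -> G}).
Hypothesis fR : forall x, R x -> f x = 1.

Lemma normal_closure_ker x : normal_closure R x -> f x = 1.
Proof.
elim=> {x} [x /fR //||x y _ x1 _ y1|x _ x1|x y _ x1]; first exact: hom1.
- by rewrite gmulfM x1 y1 mulg1.
- by rewrite homV x1 invg1.
by rewrite homJ x1 conj1g.
Qed.

Lemma qn_pi_ker x y : qn_pi R x = qn_pi R y -> f x = f y.
Proof.
move/qn_piP/normal_closure_ker; rewrite gmulfM homV => /mulg1_eq.
by rewrite invgK.
Qed.

Fact qn_hom_fun_morph :
  {morph (fun u : quot_nclosure R => f (repr u)) : u v / u * v}.
Proof.
move=> u v; rewrite -gmulfM; apply: qn_pi_ker.
by rewrite qn_reprK.
Qed.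

Definition qn_hom : {multiplicative quot_nclosure R -> G} := mkhom qn_hom_fun_morph.

Lemma qn_homE x : qn_hom (qn_pi R x) = f x.
Proof. by apply: qn_pi_ker; rewrite qn_reprK. Qed.

End QuotientHom.

Lemma qn_pi_hom (F : groupType) (R : set F) : {morph qn_pi R : x y / x * y}.
Proof. by move=> x y; rewrite -qn_mulE. Qed.

Section BraidGenerators.
Variable n : nat.
Local Notation B := (braid_group n.+1).

(** Indices range over all natural numbers, with value 1 out of bounds, so that
    far commutation holds without an upper bound and index arithmetic stays in
    [nat]. *)
Definition braid_gen (i : nat) : B :=
  if insub i is Some o then qn_pi (@braid_relator n.+1) (free_gen (o : 'I_n)) else 1.

Definition braid_pi : {multiplicative free_group 'I_n -> B} :=
  mkhom (@qn_pi_hom _ (@braid_relator n.+1)).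

Lemma braid_genE i (lt_in : (i < n)%N) :
  braid_gen i = braid_pi (free_gen (Ordinal lt_in)).
Proof. by rewrite /braid_gen insubT. Qed.

Lemma braid_gen_out i : (n <= i)%N -> braid_gen i = 1.
Proof. by move=> le_ni; rewrite /braid_gen insubF // ltnNge le_ni. Qed.

Lemma braid_relatorP u v : @braid_relator n.+1 (u / v) -> braid_pi u = braid_pi v.
Proof.
move=> Ruv; apply: divg1_eq; rewrite -homV -gmulfM.
by apply/esym/qn_piP; rewrite invg1 mul1g; apply: NClosureRel.
Qed.

Lemma braid_far i j : (i.+1 < j)%N -> commute (braid_gen i) (braid_gen j).
Proof.
move=> lt_ij; have [lt_jn|le_nj] := ltnP j n; last first.
  by rewrite (braid_gen_out le_nj); apply: commute1.
have lt_in : (i < n)%N by apply: leq_trans lt_jn; apply: ltnW (ltnW lt_ij).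
rewrite !braid_genE /commute -!gmulfM; apply: braid_relatorP.
exact: BraidFar.
Qed.

Lemma braid_near i : (i.+1 < n)%N ->
  braid_gen i * braid_gen i.+1 * braid_gen i =
  braid_gen i.+1 * braid_gen i * braid_gen i.+1.
Proof.
move=> lt_i1n; have lt_in := ltnW lt_i1n.
rewrite !braid_genE -!gmulfM; apply: braid_relatorP.
exact: BraidNear.
Qed.

Lemma braid_ind (P : B -> Prop) : P 1 ->
    (forall x i, (i < n)%N -> P x -> P (x * braid_gen i) /\ P (x / braid_gen i)) ->
  forall x, P x.
Proof.
move=> P1 PM x; rewrite -[x]qn_reprK -[qn_pi _ _]/(braid_pi (repr x)).
rewrite -[repr x]invgK; move: (repr x)^-1 => {x}; apply: free_ind => [|[o b] x Px].
  by rewrite invg1 hom1.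
rewrite invgM gmulfM [X in _ * X]homV -letter_val_gen /letter_val /=.
have := PM _ o (ltn_ord o) Px; rewrite braid_genE.
have -> : Ordinal (ltn_ord o) = o by apply/val_inj.
case: b => -[PMl PMr]; last exact: PMr.
by rewrite -[braid_pi (free_gen o)]invgK -homV in PMl.
Qed.

Section Hom.
Variables (G : groupType) (s : nat -> G).
Hypothesis s_far : forall i j, (i.+1 < j)%N -> (j < n)%N -> commute (s i) (s j).
Hypothesis s_near : forall i, (i.+1 < n)%N ->
  s i * s i.+1 * s i = s i.+1 * s i * s i.+1.

Fact braid_hom_subproof x :
  @braid_relator n.+1 x -> free_hom (fun o : 'I_n => s o) x = 1.
Proof.
case=> [i j lt_ij|i j Dj]; rewrite !gmulfM homV !gmulfM !free_hom_gen.
  by rewrite s_far ?mulgV //; exact: (ltn_ord j).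
by rewrite -Dj s_near ?mulgV // Dj; exact: (ltn_ord j).
Qed.

Definition braid_hom : {multiplicative B -> G} := qn_hom braid_hom_subproof.

Lemma braid_hom_gen i : (i < n)%N -> braid_hom (braid_gen i) = s i.
Proof. by move=> lt_in; rewrite braid_genE [LHS]qn_homE free_hom_gen. Qed.

End Hom.

Lemma eq_braid_hom (G : groupType) (f g : {multiplicative B -> G}) :
  (forall i, (i < n)%N -> f (braid_gen i) = g (braid_gen i)) -> f =1 g.
Proof.
move=> fg; apply: braid_ind => [|x i lt_in fgx]; first by rewrite !hom1.
by rewrite !gmulfM !homV fgx fg.
Qed.

End BraidGenerators.

(** The combing of braids, in terms of abstract generators [s i], [i < N], that
    satisfy the braid relations. The strand of index [N] is moved to position
    [k] by [sweep k = s (N - 1) ... s k], and [pure_gen k] wraps it around the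
    strand of index [k]. *)
Section Combing.
Variables (G : groupType) (s : nat -> G) (N : nat).
Hypothesis s_far : forall i j, (i.+1 < j)%N -> commute (s i) (s j).
Hypothesis s_near : forall i, (i.+1 < N)%N ->
  s i * s i.+1 * s i = s i.+1 * s i * s i.+1.

Fixpoint descent k m : G := if m is m'.+1 then descent k.+1 m' * s k else 1.

Lemma descentS k m : descent k m.+1 = descent k.+1 m * s k.
Proof. by []. Qed.

Definition sweep k := descent k (N - k).

Lemma sweep_last : sweep N = 1.
Proof. by rewrite /sweep subnn. Qed.

Lemma sweepS k : (k < N)%N -> sweep k = sweep k.+1 * s k.
Proof. by move=> lt_kN; rewrite /sweep -(subnSK lt_kN). Qed.

Lemma descent_far k m j : (j.+1 < k)%N -> commute (s j) (descent k m).
Proof.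
elim: m k => [|m IHm] k lt_jk /=; first exact: commute1.
by apply: commuteM; [apply/IHm/ltnW | apply: s_far].
Qed.

Lemma descent_near k m i : (k + m <= N)%N -> (k <= i)%N -> (i.+1 < k + m)%N ->
  descent k m * s i.+1 = s i * descent k m.
Proof.
elim: m k => [|m IHm] k le_kmN le_ki lt_ikm /=.
  by rewrite addn0 ltnNge ltnW in lt_ikm.
move: le_ki; rewrite leq_eqVlt => /predU1P[Dk|lt_ki]; last first.
  rewrite -mulgA (s_far (lt_ki : (k.+1 < i.+1)%N)) mulgA IHm ?mulgA //.
    by rewrite addSnnS.
  by rewrite addSnnS.
rewrite -Dk in lt_ikm *; case: m {IHm} => [|m] in le_kmN lt_ikm *.
  by rewrite addn1 ltnn in lt_ikm.
rewrite /= -!mulgA (mulgA (s k.+1)) -s_near; last first.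
  by apply: leq_trans le_kmN; rewrite !addnS !ltnS leq_addr.
by rewrite !mulgA -(descent_far m (ltnSn k.+1)).
Qed.

Lemma sweep_far k j : (j.+1 < k)%N -> commute (s j) (sweep k).
Proof. exact: descent_far. Qed.

Lemma sweep_near k i : (k <= i)%N -> (i.+1 < N)%N -> sweep k * s i.+1 = s i * sweep k.
Proof.
move=> le_ki lt_iN; have le_kN : (k <= N)%N by apply: leq_trans (ltnW (ltnW lt_iN)).
by apply: descent_near; rewrite ?subnKC.
Qed.

Definition pure_gen k := s k ^+ 2 ^ (sweep k.+1)^-1.

Lemma braid_conj k : (k.+1 < N)%N -> s k ^ (s k * s k.+1)^-1 = s k.+1.
Proof.
by move=> lt_k; rewrite conjgE invgK mulgA s_near // -(mulgA (s k.+1)) mulgK.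
Qed.

Lemma pure_gen_far k j :
  (j.+1 < k)%N || (k < j)%N -> (j.+1 < N)%N -> commute (s j) (pure_gen k).
Proof.
move=> /orP[lt_jk|lt_kj] lt_jN; rewrite /pure_gen.
  have jX : commute (s j) (sweep k.+1) by apply/sweep_far/ltnW.
  rewrite conjgE invgK; apply: commuteM => //.
  by apply: commuteM; [apply/commuteX/s_far | apply: commuteV].
have -> : s j = s j.+1 ^ (sweep k.+1)^-1.
  by rewrite conjgE invgK mulgA sweep_near // mulgK.
rewrite /commute -!conjMg; congr (_ ^ _).
exact: (commuteX 2 (commute_sym (s_far (lt_kj : (k.+1 < j.+1)%N)))).
Qed.

Lemma pure_gen_up k : (k.+1 < N)%N -> pure_gen k ^ (s k)^-1 = pure_gen k.+1.
Proof.
move=> lt_k1N; rewrite /pure_gen (sweepS lt_k1N) -conjgM invgM.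
have kX : commute (s k) (sweep k.+2) by apply: sweep_far.
rewrite -mulgA -invgM kX invgM mulgA -invgM conjgM.
by rewrite conjXg braid_conj.
Qed.

Lemma pure_gen_down k : (k.+1 < N)%N ->
  pure_gen k.+1 ^ (s k)^-1 = pure_gen k ^ pure_gen k.+1.
Proof.
move=> lt_k1N; have kX : commute (s k) (sweep k.+2) by apply: sweep_far.
have E1 : pure_gen k = (s k ^+ 2 ^ (s k.+1)^-1) ^ (sweep k.+2)^-1.
  by rewrite /pure_gen (sweepS lt_k1N) -conjgM -invgM.
have E2 : pure_gen k.+1 ^ (s k)^-1 = (s k.+1 ^+ 2 ^ (s k)^-1) ^ (sweep k.+2)^-1.
  by rewrite /pure_gen -!conjgM -!invgM kX.
rewrite E2 E1 [pure_gen k.+1]/pure_gen -conjJg; congr (_ ^ _).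
have -> : (s k ^+ 2 ^ (s k.+1)^-1) ^ (s k.+1 ^+ 2) = s k ^+ 2 ^ s k.+1.
  by rewrite -conjgM expg2 mulKg.
rewrite !conjXg; congr (_ ^+ 2).
have /(congr1 (fun x => (s k.+1)^-1 * x * (s k)^-1)) := s_near lt_k1N.
by rewrite !conjgE invgK !mulgA mulgK mulVg mul1g => <-.
Qed.

Definition pure_hom : {multiplicative free_group 'I_N -> G} :=
  free_hom (fun o : 'I_N => pure_gen o).

Definition is_pure y := exists w, y = pure_hom w.

Lemma is_pure_gen k : (k < N)%N -> is_pure (pure_gen k).
Proof. by move=> lt_kN; exists (free_gen (Ordinal lt_kN)); rewrite free_hom_gen. Qed.

Lemma is_pureM y y' : is_pure y -> is_pure y' -> is_pure (y * y').
Proof. by move=> [w ->] [w' ->]; exists (w * w'); rewrite gmulfM. Qed.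

Lemma is_pureV y : is_pure y -> is_pure y^-1.
Proof. by move=> [w ->]; exists w^-1; rewrite homV. Qed.

Lemma is_pureJ y y' : is_pure y -> is_pure y' -> is_pure (y ^ y').
Proof.
by move=> py py'; rewrite conjgE; apply: is_pureM (is_pureV _) (is_pureM _ _).
Qed.

Lemma pure_genJ j k : (j.+1 < N)%N -> (k < N)%N ->
  is_pure (pure_gen k ^ s j) /\ is_pure (pure_gen k ^ (s j)^-1).
Proof.
move=> lt_j1N lt_kN; have lt_jN := ltnW lt_j1N.
have [jk|] := boolP ((j.+1 < k)%N || (k < j)%N).
  have /commgP := pure_gen_far jk lt_j1N; rewrite commg1_sym -conjg_fix => /eqP Ek.
  by rewrite -{2}Ek conjgK Ek; split; apply: is_pure_gen.
rewrite negb_or -!leqNgt => /andP[le_kj le_jk].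
have pj := is_pure_gen lt_jN; have pj1 := is_pure_gen lt_j1N.
have up := pure_gen_up lt_j1N; have down := pure_gen_down lt_j1N.
have up' : pure_gen j.+1 ^ s j = pure_gen j by rewrite -up conjgKV.
have down' : pure_gen j ^ s j = pure_gen j.+1 ^ (pure_gen j)^-1.
  apply: (conjg_inj (pure_gen j)); rewrite -[RHS]conjgM mulVg conjg1.
  by rewrite -{2}up' -conjJg -down conjgKV.
move: le_jk; rewrite leq_eqVlt => /predU1P[<-|lt_jk].
  by rewrite up down'; split=> //; apply/is_pureJ/is_pureV.
have -> : k = j.+1 by apply/eqP; rewrite eqn_leq le_kj.
by rewrite up' down; split=> //; apply: is_pureJ.
Qed.

(** The pure motions of the strand [N] are normalized by the braids of the strands
    below it. *)
Lemma is_pure_conj j y : (j.+1 < N)%N -> is_pure y ->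
  is_pure (y ^ s j) /\ is_pure (y ^ (s j)^-1).
Proof.
move=> lt_j1N [w ->{y}]; move: w; apply: free_ind => [|[o b] w [IHw IHw']].
  by rewrite hom1 !conj1g; split; exists 1; rewrite hom1.
have [po po'] := pure_genJ lt_j1N (ltn_ord o).
have -> : pure_hom (free_letter (o, b) * w) =
    (if b then (pure_gen o)^-1 else pure_gen o) * pure_hom w.
  by rewrite gmulfM; congr (_ * _); case: b; rewrite [LHS]mulg1.
move: (pure_hom w) IHw IHw' => y py py'; rewrite !conjMg.
by case: b; rewrite ?conjVg; split; apply: is_pureM => //; apply: is_pureV.
Qed.

Variables (K : groupType) (t : nat -> K) (iota : {multiplicative K -> G}).
Hypothesis iota_t : forall j, (j.+1 < N)%N -> iota (t j) = s j.

(** Artin's combed form: a braid of the strands below [N], then a pure motion of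
    the strand [N] around them, then a sweep. *)
Definition combed x := exists b w k,
  (k <= N)%N /\ x = iota b * pure_hom w * sweep k.

Lemma combed1 : combed 1.
Proof. by exists 1, 1, N; rewrite leqnn !hom1 sweep_last !mulg1. Qed.

Lemma combed_left b w k c x : (k <= N)%N ->
    (forall y, is_pure y -> is_pure (y ^ iota c)) ->
    x = iota b * pure_hom w * (iota c * sweep k) ->
  combed x.
Proof.
move=> le_kN pJ ->; have [|w' Dw'] := pJ (pure_hom w); first by exists w.
exists (b * c), w', k; split=> //.
by rewrite -Dw' gmulfM conjgE !mulgA mulgK.
Qed.

(** A generator to the right of [sweep k] moves to the left of it as another
    generator below [N] that normalizes the pure motions, or changes [k] by one up
    to a pure motion. *)
Lemma combed_mul x j : (j < N)%N -> combed x ->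
  combed (x * s j) /\ combed (x / s j).
Proof.
move=> lt_jN [b [w [k [le_kN ->]]]]; rewrite -2!(mulgA (_ * _)).
have low i : (i.+1 < N)%N -> sweep k * s j = s i * sweep k ->
    combed (iota b * pure_hom w * (sweep k * s j)) /\
    combed (iota b * pure_hom w * (sweep k / s j)).
  move=> lt_iN Ek; have Ek' : sweep k / s j = (s i)^-1 * sweep k.
    by apply: (mulIg (s j)); rewrite mulgVK -mulgA Ek mulKg.
  split; rewrite ?Ek ?Ek' -iota_t // -?homV; apply: combed_left erefl => // y;
    by move=> /(is_pure_conj lt_iN)[]; rewrite ?homV iota_t.
have [lt_j1k|le_kj1] := ltnP j.+1 k.
  apply: (low j); first exact: leq_trans lt_j1k le_kN.
  exact/esym/sweep_far.
have [lt_kj|le_jk] := ltnP k j.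
  case: j => // j in lt_jN low le_kj1 lt_kj *.
  by apply: (low j) => //; apply: sweep_near.
have pmul w' y : pure_hom w * pure_hom w' * y = pure_hom (w * w') * y.
  by rewrite gmulfM.
have pj : pure_gen j = pure_hom (free_gen (Ordinal lt_jN)) by rewrite free_hom_gen.
have sj : sweep j.+1 * (s j * s j) = pure_gen j * sweep j.+1.
  by rewrite /pure_gen expg2 conjgE invgK !mulgA mulgVK.
move: le_jk; rewrite leq_eqVlt => /predU1P[Dj|lt_jk].
  rewrite -Dj (sweepS lt_jN) mulgK; split; last by exists b, w, j.+1.
  exists b, (w * free_gen (Ordinal lt_jN)), j.+1; split=> //.
  by rewrite -(mulgA (sweep _)) sj pj gmulfM !mulgA.
have Dk : k = j.+1 by apply/eqP; rewrite eqn_leq le_kj1.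
rewrite Dk -(sweepS lt_jN); split; first by exists b, w, j; rewrite ltnW.
exists b, (w * (free_gen (Ordinal lt_jN))^-1), j; split; first exact: ltnW.
rewrite gmulfM homV -pj -!mulgA (sweepS lt_jN); congr (_ * (_ * _)).
by apply: (mulgI (pure_gen j)); rewrite mulVKg mulgA -sj -!mulgA mulgV mulg1.
Qed.

End Combing.

Lemma hom_descent (G H : groupType) (f : {multiplicative G -> H}) s s' N k m :
    (forall i, (i < N)%N -> f (s i) = s' i) -> (k + m <= N)%N ->
  f (descent s k m) = descent s' k m.
Proof.
move=> fs; elim: m k => [|m IHm] k le_kmN /=; first exact: hom1.
rewrite gmulfM IHm ?addSnnS // fs //.
by apply: leq_trans le_kmN; rewrite addnS ltnS leq_addr.
Qed.

Lemma hom_sweep (G H : groupType) (f : {multiplicative G -> H}) s s' N k :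
    (forall i, (i < N)%N -> f (s i) = s' i) -> (k <= N)%N ->
  f (sweep s N k) = sweep s' N k.
Proof. by move=> fs le_kN; apply: (hom_descent fs); rewrite subnKC. Qed.

Lemma hom_pure_gen (G H : groupType) (f : {multiplicative G -> H}) s s' N k :
    (forall i, (i < N)%N -> f (s i) = s' i) -> (k < N)%N ->
  f (pure_gen s N k) = pure_gen s' N k.
Proof.
by move=> fs lt_kN; rewrite /pure_gen homJ homV homX fs // (hom_sweep fs).
Qed.

(** * Artin's representation *)

Section Artin.
Local Notation F := (free_group nat).
Local Notation x := (@free_gen nat).

Definition artin_image i j : F :=
  if j == i then x i.+1 else if j == i.+1 then x i ^ x i.+1 else x j.

Definition artin_preimage i j : F :=
  if j == i then x i.+1 ^ (x i)^-1 else if j == i.+1 then x i else x j.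

Lemma artin_image1 i : artin_image i i = x i.+1.
Proof. by rewrite /artin_image eqxx. Qed.

Lemma artin_image2 i : artin_image i i.+1 = x i ^ x i.+1.
Proof. by rewrite /artin_image eqxx (gtn_eqF (ltnSn i)). Qed.

Lemma artin_image3 i j : j != i -> j != i.+1 -> artin_image i j = x j.
Proof. by rewrite /artin_image => /negPf-> /negPf->. Qed.

Lemma artin_preimage1 i : artin_preimage i i = x i.+1 ^ (x i)^-1.
Proof. by rewrite /artin_preimage eqxx. Qed.

Lemma artin_preimage2 i : artin_preimage i i.+1 = x i.
Proof. by rewrite /artin_preimage eqxx (gtn_eqF (ltnSn i)). Qed.

Lemma artin_preimage3 i j : j != i -> j != i.+1 -> artin_preimage i j = x j.
Proof. by rewrite /artin_preimage => /negPf-> /negPf->. Qed.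

Fact artinK i : cancel (free_hom (artin_image i)) (free_hom (artin_preimage i)).
Proof.
apply: (eq_free_end_id
  (f := free_hom (artin_preimage i) \o free_hom (artin_image i))) => j.
rewrite /= [free_hom (artin_image i) _]free_hom_gen.
have [->|ne_ji] := eqVneq j i.
  by rewrite artin_image1 free_hom_gen artin_preimage2.
have [->|ne_ji1] := eqVneq j i.+1.
  by rewrite artin_image2 homJ !free_hom_gen artin_preimage1 artin_preimage2 conjgKV.
by rewrite artin_image3 // free_hom_gen artin_preimage3.
Qed.

Fact artinKV i : cancel (free_hom (artin_preimage i)) (free_hom (artin_image i)).
Proof.
apply: (eq_free_end_id
  (f := free_hom (artin_image i) \o free_hom (artin_preimage i))) => j.
rewrite /= [free_hom (artin_preimage i) _]free_hom_gen.
have [->|ne_ji] := eqVneq j i.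
  by rewrite artin_preimage1 homJ homV !free_hom_gen artin_image1 artin_image2 conjgK.
have [->|ne_ji1] := eqVneq j i.+1.
  by rewrite artin_preimage2 free_hom_gen artin_image1.
by rewrite artin_preimage3 // free_hom_gen artin_image3.
Qed.

(** Letting all braid groups act on one free group of infinite rank makes the
    action of a braid independent of the number of strands. *)
Definition artin i : aut F := mkaut (artinK i) (artinKV i).

Lemma artin1 i : artin i (x i) = x i.+1.
Proof. by rewrite -artin_image1; apply: free_hom_gen. Qed.

Lemma artin2 i : artin i (x i.+1) = x i ^ x i.+1.
Proof. by rewrite -artin_image2; apply: free_hom_gen. Qed.

Lemma artin3 i j : j != i -> j != i.+1 -> artin i (x j) = x j.
Proof.
by move=> ne1 ne2; rewrite -[RHS](artin_image3 ne1 ne2); apply: free_hom_gen.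
Qed.

Lemma artin_lt i j : (j < i)%N -> artin i (x j) = x j.
Proof. by move=> lt_ji; rewrite artin3 ?ltn_eqF // ltnW. Qed.

Lemma artin_gt i j : (i.+1 < j)%N -> artin i (x j) = x j.
Proof. by move=> lt_ij; rewrite artin3 // gtn_eqF // ltnW. Qed.

Lemma artin_far i j : (i.+1 < j)%N -> commute (artin i) (artin j).
Proof.
move=> lt_ij; apply: aut_free_eq => k; rewrite !autM.
have [->|ne_ki] := eqVneq k i.
  by rewrite (artin_lt (ltnW lt_ij)) artin1 artin_lt.
have [->|ne_ki1] := eqVneq k i.+1.
  by rewrite artin_lt // artin2 aut_homJ !artin_lt // ltnW.
have [->|ne_kj] := eqVneq k j.
  by rewrite (artin_gt lt_ij) artin1 artin_gt // ltnW.
have [->|ne_kj1] := eqVneq k j.+1.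
  have lt_ij1 : (i.+1 < j.+1)%N by apply: ltnW.
  by rewrite (artin_gt lt_ij1) artin2 aut_homJ !artin_gt.
by rewrite !artin3.
Qed.

Lemma artin_near i : artin i * artin i.+1 * artin i = artin i.+1 * artin i * artin i.+1.
Proof.
apply: aut_free_eq => k; rewrite !autM.
have lt1 := artin_lt (ltnSn i); have gt1 := artin_gt (ltnSn i.+1).
have [->|ne_ki] := eqVneq k i; first by rewrite !artin1 lt1 !artin1 gt1.
have [->|ne_ki1] := eqVneq k i.+1.
  by rewrite artin2 artin1 !aut_homJ lt1 !artin1 gt1 artin2.
have [->|ne_ki2] := eqVneq k i.+2.
  rewrite gt1 artin2 !aut_homJ artin2 gt1 !aut_homJ lt1 artin1 artin2.
  exact: conjJg.
by rewrite !artin3.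
Qed.

Section Top.
Variable N : nat.
Local Notation sw := (sweep artin N).
Local Notation pg := (pure_gen artin N).

Lemma sweep_low k j : (j < k)%N -> sw k (x j) = x j.
Proof.
rewrite /sweep; move: (N - k)%N => m; elim: m k => // m IHm k lt_jk.
by rewrite descentS autM artin_lt // IHm // ltnW.
Qed.

Lemma sweep_top k : (k <= N)%N -> sw k (x k) = x N.
Proof.
move=> le_kN; rewrite -[in RHS](subnKC le_kN) /sweep.
move: (N - k)%N => m; elim: m k {le_kN} => [|m IHm] k; first by rewrite addn0.
by rewrite descentS autM artin1 IHm addSnnS.
Qed.

Definition forget : {multiplicative F -> F} :=
  free_hom (fun j => if j == N then 1 else x j).

Lemma forget_top : forget (x N) = 1.
Proof. by rewrite [LHS]free_hom_gen eqxx. Qed.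

Lemma forget_low j : j != N -> forget (x j) = x j.
Proof. by rewrite [LHS]free_hom_gen => /negPf->. Qed.

(** [f] acts trivially when the strand [N] is forgotten, and pushes this strand
    along a loop whose class is [w]. *)
Definition pushes (f : aut F) (w : F) : Prop :=
  (forall y, forget (f y) = forget y) /\
  exists2 D, f (x N) = x N ^ D & forget D = w.

Lemma pushes1 : pushes 1 1.
Proof. by split=> //; exists 1; rewrite ?conjg1 // hom1. Qed.

Lemma pushesM f g v w : pushes f v -> pushes g w -> pushes (f * g) (v * w).
Proof.
move=> [fpi [D fN <-]] [gpi [E gN <-]]; split=> [y|].
  by rewrite autM fpi gpi.
exists (D * f E); last by rewrite gmulfM fpi.
by rewrite autM gN aut_homJ fN conjgM.
Qed.

Lemma pushesV f w : pushes f w -> pushes f^-1 w^-1.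
Proof.
move=> [fpi [D fN <-]]; have fVpi y : forget (f^-1 y) = forget y.
  by rewrite -fpi autKV.
split=> //; exists (f^-1 D)^-1; last by rewrite homV fVpi.
by rewrite -[x N in LHS](conjgK D) -fN aut_homJ autK aut_homV.
Qed.

(** [pg k] is the conjugate of [artin k ^ 2] by a sweep that takes the generators
    [k] and [k + 1] to [k] and [N]. *)
Lemma pushes_gen k : (k < N)%N -> pushes (pg k) (x k).
Proof.
move=> lt_kN; have ne_kN : k != N by rewrite ltn_eqF.
have pgX y : pg k (sw k.+1 y) = sw k.+1 (artin k (artin k y)).
  by rewrite /pure_gen expg2 conjgE invgK !autM autK.
have art2 : artin k (artin k (x k.+1)) = x k.+1 ^ (x k ^ x k.+1).
  by rewrite artin2 aut_homJ artin1 artin2.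
have swN : sw k.+1 (x k.+1) = x N by apply: sweep_top.
have swk : sw k.+1 (x k) = x k by apply: sweep_low.
split=> [y|].
  rewrite -[y](autKV (sw k.+1)) pgX; move: (_ y) => {}y.
  rewrite -[LHS]/((forget \o (sw k.+1 * artin k ^+ 2)) y).
  rewrite -[RHS]/((forget \o sw k.+1) y).
  apply: eq_free_hom => j.
  rewrite -[LHS]/(forget (sw k.+1 (artin k (artin k (x j))))).
  rewrite -[RHS]/(forget (sw k.+1 (x j))).
  have [->|ne_jk] := eqVneq j k.
    rewrite artin1 artin2 aut_homJ swN swk homJ forget_top conjg1.
    by [].
  have [->|ne_jk1] := eqVneq j k.+1.
    by rewrite art2 aut_homJ swN homJ forget_top conj1g.
  by rewrite !artin3.
exists (x k ^ x N); last by rewrite homJ forget_top conjg1 forget_low.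
by rewrite -[in LHS]swN pgX art2 !aut_homJ swN swk.
Qed.

Lemma pushes_pure (w : free_group 'I_N) :
  pushes (pure_hom artin N w) (free_map val w).
Proof.
move: w; apply: free_ind => [|[o b] w IHw]; first by rewrite !hom1; apply: pushes1.
rewrite !gmulfM; apply: pushesM => //; have po := pushes_gen (ltn_ord o).
have -> : pure_hom artin N (free_letter (o, b)) = if b then (pg o)^-1 else pg o.
  by case: b; rewrite [LHS]mulg1.
have -> : free_map val (free_letter (o, b)) = if b then (x o)^-1 else x o.
  by case: b; apply/val_inj.
by case: b => //; apply: pushesV.
Qed.

(** The letters of [y] on the generator [N] can be stripped from the left; if
    another letter comes first, then [y] and this generator do not commute, by
    the comparison of first letters used in [free_center]. *)
Lemma forget_centralizer y : commute y (x N) -> forget y = 1.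
Proof.
have [m] := ubnP (size (word_of y)); elim: m y => // m IHm y lt_ym yC.
have [->|y_n1] := eqVneq y 1; first exact: hom1.
case Dy: (word_of y) y_n1 => [|a s]; first by rewrite free_eq1 Dy.
move=> _; have red_y : reduced (a :: s) by rewrite -Dy free_group_reduced.
have yCl b : commute y (free_letter (N, b)).
  by rewrite -letter_val_gen /letter_val; case: b; rewrite /=; [apply: commuteV|].
have [Da|ne_aN] := eqVneq a.1 N.
  have red_s := path_sorted red_y.
  have Ey : y = free_letter a * FreeGroup red_s.
    by apply/val_inj; rewrite /= -[LHS]/(word_of y) Dy -[LHS]reduce_id.
  have aN : free_letter a = free_letter (N, a.2) by rewrite -Da; case: (a).
  rewrite Ey gmulfM [X in _ * X]IHm.
  - rewrite mulg1 -letter_val_gen /letter_val Da.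
    by case: a.2; rewrite ?homV forget_top ?invg1.
  - by rewrite /= -ltnS (leq_trans _ lt_ym) // Dy.
  apply: (mulgI (free_letter a)); rewrite !mulgA -Ey yC Ey aN.
  by rewrite -letter_val_gen /letter_val; case: a.2; rewrite /= ?mulgA ?mulgV ?mulVg.
pose c := (N, (last a s).2).
have red1 : reduced (word_of (free_letter c) ++ word_of y).
  rewrite Dy -[_ ++ _]/(c :: [::] ++ a :: s) reduced_cat_cons red_y /=.
  by apply: contra ne_aN => /eqP ->.
have red2 : reduced (word_of y ++ word_of (free_letter c)).
  rewrite Dy cat_cons reduced_cat_cons red_y /= /flip_letter /c.
  by apply/eqP => -[_]; case: ((last a s).2).
have := congr1 (@word_of nat) (yCl (last a s).2); rewrite !word_ofM_reduced // Dy /=.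
by case=> Ea; move: ne_aN; rewrite Ea eqxx.
Qed.

End Top.

Definition artin_hom n : {multiplicative braid_group n.+1 -> aut F} :=
  braid_hom (fun i j lt_ij _ => artin_far lt_ij) (fun i _ => artin_near i).

Lemma artin_hom_gen n i : (i < n)%N -> artin_hom n (braid_gen n i) = artin i.
Proof. by move=> lt_in; apply: braid_hom_gen. Qed.

Lemma artin_hom_fix n b j : (n < j)%N -> artin_hom n b (x j) = x j.
Proof.
move=> lt_nj; move: b; apply: braid_ind => [|b i lt_in IHb]; first by rewrite hom1.
have fix_i : artin i (x j) = x j by apply: artin_gt; apply: leq_trans lt_nj.
rewrite !gmulfM homV artin_hom_gen // !autM fix_i; split=> //.
by rewrite -[in LHS]fix_i autK.
Qed.

(** Faithfulness. The sweep factor of a combed element of the kernel is trivial,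
    because the strand [N] ends where it started; its pure factor is trivial,
    because it pushes the strand [N] along a trivial loop; what remains is a
    braid on fewer strands. *)
Lemma artin_hom_inj n : injective (artin_hom n).
Proof.
elim: n => [|n IHn]; apply: hom_inj.
  by apply: braid_ind.
move=> b b1; pose N := n.+1; set s := braid_gen n.+1.
have s_far i j : (i.+1 < j)%N -> commute (s i) (s j) by apply: braid_far.
have s_near i : (i.+1 < n.+1)%N -> s i * s i.+1 * s i = s i.+1 * s i * s i.+1.
  exact: braid_near.
pose iota : {multiplicative braid_group n.+1 -> braid_group n.+2} :=
  braid_hom (fun i j lt_ij _ => s_far i j lt_ij)
            (fun i lt_in => s_near i (leqW lt_in)).
have iota_s j : (j.+1 < n.+1)%N -> iota (braid_gen n j) = s j.
  by move=> lt_jn; rewrite /iota braid_hom_gen.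
have : combed s N iota b.
  move: b {b1}; apply: braid_ind => [|b i lt_in comb_b]; first exact: combed1.
  exact: (combed_mul s_far s_near iota_s).
case=> c [w [k [le_kN Db]]].
have rho_s i : (i < N)%N -> artin_hom n.+1 (s i) = artin i by apply: artin_hom_gen.
have rho_iota : artin_hom n.+1 (iota c) = artin_hom n c.
  rewrite -[LHS]/((artin_hom n.+1 \o iota) c); apply: eq_braid_hom => i lt_in.
  rewrite -[LHS]/(artin_hom n.+1 (iota (braid_gen n i))).
  by rewrite iota_s // rho_s ?artin_hom_gen // ltnW.
have rho_w : artin_hom n.+1 (pure_hom s N w) = pure_hom artin N w.
  rewrite -[LHS]/((artin_hom n.+1 \o pure_hom s N) w); apply: eq_free_hom => o.
  rewrite -[LHS]/(artin_hom n.+1 (pure_hom s N (free_gen o))).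
  by rewrite [pure_hom s N _]free_hom_gen [RHS]free_hom_gen (hom_pure_gen rho_s).
move: b1; rewrite Db !gmulfM rho_iota rho_w (hom_sweep rho_s) // => b1.
have [_ [D wN Dw]] := pushes_pure w.
have b_fix : artin_hom n c (x N) = x N by apply: artin_hom_fix.
have kN : k = N.
  apply/eqP/negPn/negP => ne_kN.
  have := congr1 (fun f : aut F => forget N (f (x k))) b1.
  rewrite !autM sweep_top // wN aut_homJ b_fix homJ forget_top conj1g.
  by rewrite [RHS]forget_low // => /esym/eqP; rewrite (negPf (free_gen_neq1 _)).
rewrite {}kN !sweep_last !mulg1 in b1 Db *.
have w1 : w = 1.
  have val_ord_inj : injective (val : 'I_N -> nat) by apply: val_inj.
  apply: (free_map_inj val_ord_inj); rewrite hom1 -Dw.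
  have xD : x N ^ D = x N.
    have := congr1 (fun f : aut F => f (x N)) b1.
    by rewrite autM wN -[in RHS]b_fix => /(can_inj (autK (artin_hom n c))).
  by apply/forget_centralizer/commute_sym/commgP; rewrite -conjg_fix xD.
have c1 : c = 1 by apply: IHn; rewrite hom1 -b1 w1 hom1 mulg1.
by rewrite w1 c1 !hom1 !mul1g.
Qed.

End Artin.

(** A braid on [n + 1] strands involves the first [n + 1] generators only, so
    that its action restricts to them; [retract] turns this restriction into an
    endomorphism of the free group on these generators. *)
Section ArtinRestriction.
Variable n : nat.
Local Notation J := (free_map (val : 'I_n.+1 -> nat)).
Local Notation x := (@free_gen nat).

Definition retract : {multiplicative free_group nat -> free_group 'I_n.+1} :=
  free_hom (fun k => if insub k is Some o then free_gen (o : 'I_n.+1) else 1).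

Lemma retractK : cancel J retract.
Proof.
apply: (eq_free_end_id (f := retract \o J)) => o /=.
by rewrite [J _]free_map_gen [LHS]free_hom_gen valK.
Qed.

Definition supported y := J (retract y) = y.

Lemma supported_map y : supported (J y).
Proof. by rewrite /supported retractK. Qed.

Lemma supported_gen k : (k <= n)%N -> supported (x k).
Proof.
move=> le_kn; rewrite -[k]/(val (Ordinal (le_kn : (k < n.+1)%N))) -free_map_gen.
exact: supported_map.
Qed.

Lemma supportedV y : supported y -> supported y^-1.
Proof. by rewrite /supported !homV => ->. Qed.

Lemma supportedJ y z : supported y -> supported z -> supported (y ^ z).
Proof. by rewrite /supported !homJ => -> ->. Qed.

Lemma supported_hom (f : {multiplicative free_group nat -> free_group nat}) :
  (forall k, (k <= n)%N -> supported (f (x k))) ->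
  forall y, supported y -> supported (f y).
Proof.
move=> fx y <-; move: (retract y) => {}y.
rewrite /supported -[LHS]/((J \o retract \o f \o J) y) -[RHS]/((f \o J) y).
apply: eq_free_hom => o.
rewrite -[LHS]/(J (retract (f (J (free_gen o))))) -[RHS]/(f (J (free_gen o))).
rewrite free_map_gen.
exact: (fx o (ltn_ord o)).
Qed.

Lemma artin_hom_supported b y : supported y -> supported (artin_hom n b y).
Proof.
have gen i : (i < n)%N -> forall y, supported y ->
    supported (artin i y) /\ supported ((artin i)^-1 y).
  move=> lt_in; have xi := supported_gen (ltnW lt_in); have xi1 := supported_gen lt_in.
  have im_gen k : (k <= n)%N -> supported (artin i (x k)).
    move=> le_kn; have [->|ne_ki] := eqVneq k i; first by rewrite artin1.
    have [->|ne_ki1] := eqVneq k i.+1; first by rewrite artin2; apply: supportedJ.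
    by rewrite artin3 //; apply: supported_gen.
  have im y' : supported y' -> supported (artin i y') by exact: supported_hom im_gen y'.
  move=> y' sy'; split; first exact: im.
  have Ei : (artin i)^-1 =1 free_hom (artin_preimage i).
    by move=> z; apply: (can_inj (autK (artin i))); rewrite autKV; apply/esym/artinKV.
  rewrite Ei; apply: supported_hom sy' => k le_kn; rewrite free_hom_gen.
  have [->|ne_ki] := eqVneq k i.
    by rewrite artin_preimage1; apply: supportedJ => //; apply: supportedV.
  have [->|ne_ki1] := eqVneq k i.+1; first by rewrite artin_preimage2.
  by rewrite artin_preimage3 //; apply: supported_gen.
move: b y; apply: braid_ind => [y|b i lt_in IHb]; first by rewrite hom1.
rewrite !gmulfM homV artin_hom_gen //; split=> y sy; apply: IHb.
  by have [] := gen i lt_in y sy.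
by have [] := gen i lt_in y sy.
Qed.

Definition artin_restr_fun b :
    {multiplicative free_group 'I_n.+1 -> free_group 'I_n.+1} :=
  retract \o (artin_hom n b \o J).

Fact artin_restr1 : artin_restr_fun 1 =1 id.
Proof. move=> y; rewrite -[LHS]/(retract (artin_hom n 1 (J y))) hom1.
exact: retractK. Qed.

Fact artin_restrM b c y :
  artin_restr_fun (b * c) y = artin_restr_fun b (artin_restr_fun c y).
Proof.
rewrite -[LHS]/(retract (artin_hom n (b * c) (J y))).
rewrite -[RHS]/(retract (artin_hom n b (J (retract (artin_hom n c (J y)))))).
have -> : J (retract (artin_hom n c (J y))) = artin_hom n c (J y).
  exact/artin_hom_supported/supported_map.
by rewrite gmulfM.
Qed.

Definition artin_restr :
    {multiplicative braid_group n.+1 -> aut (free_group 'I_n.+1)} :=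
  hom_aut artin_restr1 artin_restrM.

Lemma artin_restr_inj : injective artin_restr.
Proof.
apply: hom_inj => b b1; apply: (@artin_hom_inj n); rewrite hom1.
apply: aut_free_eq => k; have [le_kn|lt_nk] := leqP k n; last by rewrite artin_hom_fix.
have sk := supported_gen le_kn; rewrite aut1.
rewrite -[LHS](artin_hom_supported b sk) -{1}sk.
have := congr1 (fun f : aut _ => f (retract (x k))) b1.
by rewrite aut1 => E; rewrite -[RHS]sk -[in RHS]E.
Qed.

Lemma contains_braid : contains (aut (free_group 'I_n.+1)) (braid_group n.+1).
Proof. by exists artin_restr; exact: artin_restr_inj. Qed.

End ArtinRestriction.

Local Close Scope group_scope.
Import Order.TTheory GRing.Theory Num.Theory.
Local Open Scope ring_scope.

(** * Splitting fields and logarithms *)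

Lemma irreducible_factor (K : fieldType) (p : {poly K}) :
  (1 < size p)%N -> exists2 q, irreducible_poly q & q %| p.
Proof.
have [n] := ubnP (size p); elim: n p => // n IHn p lt_pn p_gt1.
have [[q [q_n1 q_p ne_qp]]|irr_p] := pselect (exists q : {poly K},
    [/\ size q != 1%N, q %| p & ~~ (q %= p)]); last first.
  exists p; last exact: dvdpp.
  split=> // q q_n1 q_p; apply/negPn/negP => ne_qp.
  by apply: irr_p; exists q.
have p_n0 : p != 0 by rewrite -size_poly_gt0 ltnW.
have q_n0 : q != 0 by apply: contraTneq q_p => ->; rewrite dvd0p.
have lt_qp : (size q < size p)%N.
  by rewrite ltn_neqAle dvdp_leq // andbT -(dvdp_size_eqp q_p) in ne_qp *.
have [||r irr_r r_q] := IHn q.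
- exact: leq_trans lt_qp lt_pn.
- by rewrite ltn_neqAle eq_sym q_n1 size_poly_gt0.
by exists r => //; apply: dvdp_trans q_p.
Qed.

Lemma splitting_ext (K : fieldType) (p : {poly K}) : p \is monic ->
  exists (L : fieldType) (f : {rmorphism K -> L}) (rs : seq L),
    map_poly f p = \prod_(r <- rs) ('X - r%:P).
Proof.
have [n] := ubnP (size p); elim: n K p => // n IHn K p lt_pn p_mon.
have [p_gt1|p_le1] := ltnP 1 (size p); last first.
  exists K, idfun, [::]; rewrite big_nil map_poly_id //.
  move: p_mon; rewrite [p]size1_polyC // monicE lead_coefC => /eqP ->.
  by rewrite polyC1.
have [q irr_q q_p] := irreducible_factor p_gt1.
have [L _ [z qz _]] := irredp_FAdjoin irr_q.
have pz : root (map_poly (in_alg L) p) z.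
  rewrite -dvdp_XsubCl; apply: (@dvdp_trans _ (map_poly (in_alg L) q)).
    by rewrite dvdp_XsubCl.
  by rewrite dvdp_map.
have /factor_theorem[p' Dp] := pz.
have p'_mon : p' \is monic.
  by rewrite -(monicMr _ (monicXsubC z)) -Dp map_monic.
have [||M [f [rs Dp']]] := IHn L p' => //.
  rewrite -ltnS (leq_trans _ lt_pn) // ltnS -(size_map_poly (in_alg L) p) Dp.
  by rewrite size_Mmonic ?monicXsubC ?monic_neq0 // size_XsubC addn2.
exists M, (f \o in_alg L : {rmorphism K -> M}), (f z :: rs).
rewrite map_poly_comp Dp rmorphM /= Dp' big_cons mulrC rmorphB /=.
by rewrite map_polyX map_polyC.
Qed.

(** Let [M] be a maximal subgroup of the nonzero elements whose intersection with
    the powers of [a] is trivial. By maximality every nonzero [x] has a positive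
    power of the form [x ^ n = a ^ k * m] with [m] in [M]; the quotient [k / n]
    depends on [x] only, and is its logarithm. *)
Lemma log_exists (L : fieldType) (a : L) :
    a != 0 -> (forall n, (0 < n)%N -> a ^+ n != 1) ->
  exists2 log : L -> rat, log a != 0 &
    forall x y, x != 0 -> y != 0 -> log (x * y) = log x + log y.
Proof.
move=> a_n0 a_inf.
have a_inj k : a ^ k = 1 -> k = 0.
  case: k => [[|n]|n] // ak1; first by have /eqP := a_inf n.+1 isT.
  by have /eqP[] := a_inf n.+1 isT; apply: invr_inj; rewrite invr1; exact: ak1.
pose P (M : set L) := [/\ ~ M 0, forall x y, M x -> M y -> M (x * y),
   forall x, M x -> M x^-1 & forall k, M (a ^ k) -> k = 0].
have [F sFP chF|M [[M0 MM MV Ma] Mmax]] := @Zorn_bigcup L P.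
  split=> [[X FX X0]|x y [X FX Xx] [Y FY Yy]|x [X FX Xx]|k [X FX Xak]].
  - by have [] := sFP X FX.
  - have [sXY|sYX] := chF _ _ FX FY.
      by exists Y => //; have [_ M _ _] := sFP _ FY; apply: M => //; exact: sXY.
    by exists X => //; have [_ M _ _] := sFP _ FX; apply: M => //; exact: sYX.
  - by exists X => //; have [_ _ V _] := sFP _ FX; apply: V.
  - by have [_ _ _ Xa] := sFP _ FX; apply: Xa.
have M1 : M 1.
  have [[x Mx]|M_0] := pselect (exists x, M x).
    rewrite -(mulfV (x := x)); last by apply: contra_notN M0 => /eqP <-.
    by apply: MM => //; exact: MV.
  case: (Mmax [set 1]%classic).
    split=> [|sub]; first by move=> x Mx; case: M_0; exists x.
    by apply: M_0; exists 1; apply: sub.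
  split=> [/esym/eqP|x y -> ->|x ->|k]; rewrite ?oner_eq0 ?mulr1 ?invr1 //.
  exact: a_inj.
have nz x : M x -> x != 0 by move=> Mx; apply: contra_notN M0 => /eqP <-.
have MX x n : M x -> M (x ^+ n).
  by move=> Mx; elim: n => [|n IHn]; rewrite ?exprS ?expr0 //; apply: MM.
have MXz x k : M x -> M (x ^ k).
  by case: k => n Mx; [exact: MX | rewrite NegzE; apply/MV/MX].
have frac (x : L) : x != 0 -> exists n k, (0 < n)%N /\ M (x ^+ n / a ^ k).
  move=> x_n0; apply: contrapT => nofrac.
  have nofracz i k : M (x ^ i / a ^ k) -> i = 0.
    case: i => [[|n]|n] // Mxa; first by case: nofrac; exists n.+1, k.
    case: nofrac; exists n.+1, (- k); split=> //; move/MV: Mxa.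
    by rewrite -[x ^ Negz n]/(x ^- n.+1) invfM invrK -invr_expz.
  case: (Mmax [set y | exists i m, M m /\ y = x ^ i * m]%classic); [split|split].
  - by move=> m Mm; exists 0, m; rewrite mul1r.
  - move=> sub; suff /(nofracz 1 0) : M (x ^ 1 / a ^ 0) by [].
    by rewrite expr1z expr0z divr1; apply: sub; exists 1, 1; rewrite mulr1.
  - move=> [i [m [Mm /esym/eqP]]].
    by rewrite mulf_eq0 expfz_eq0 (negPf x_n0) andbF (negPf (nz _ Mm)).
  - move=> _ _ [i [m [Mm ->]]] [j [m' [Mm' ->]]].
    exists (i + j), (m * m'); split; first exact: MM.
    by rewrite expfzDr // mulrACA.
  - move=> _ [i [m [Mm ->]]].
    by exists (- i), m^-1; split; [apply: MV | rewrite invfM invr_expz].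
  - move=> k [i [m [Mm Dak]]]; have i0 : i = 0.
      apply: (nofracz i k); rewrite Dak invfM mulrA mulfV ?mul1r; first exact: MV.
      by rewrite expfz_neq0.
    by apply: Ma; rewrite Dak i0 mul1r.
pose N (x : L) := if pselect (x != 0) is left h then sval (cid (frac x h)) else 1%N.
have NP (x : L) : x != 0 -> exists k, (0 < N x)%N /\ M (x ^+ N x / a ^ k).
  by rewrite /N; case: pselect => // h _; exact: svalP (cid (frac x h)).
pose E (x : L) := if pselect (x != 0) is left h then sval (cid (NP x h)) else 0.
have EP (x : L) : x != 0 -> (0 < N x)%N /\ M (x ^+ N x / a ^ E x).
  by rewrite /E; case: pselect => // h _; exact: svalP (cid (NP x h)).
pose log (x : L) : rat := (E x)%:~R / (N x)%:R.
have logE x n k : x != 0 -> (0 < n)%N -> M (x ^+ n / a ^ k) ->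
    log x = k%:~R / n%:R.
  move=> x_n0 n_gt0 Mxk; have [N_gt0 MxE] := EP x x_n0.
  apply/eqP; rewrite eqr_div ?pnatr_eq0 -?lt0n //.
  rewrite -[n%:R]/(n%:~R) -[(N x)%:R]/((N x)%:~R) -!intrM eqr_int -subr_eq0.
  apply/eqP/Ma; have := MM _ _ (MX _ (N x) Mxk) (MV _ (MX _ n MxE)).
  rewrite !expr_div_n -!exprM mulnC invfM invrK mulrCA !mulrA mulVf ?mul1r; last first.
    by rewrite expf_neq0.
  by rewrite !exprnP !exprz_exp invr_expz -expfzDr // addrC.
exists log => [|x y x_n0 y_n0].
  by rewrite (logE a 1%N 1) // ?divr1 // expr1 expr1z mulfV.
have [Nx Mx] := EP x x_n0; have [Ny My] := EP y y_n0.
rewrite (logE (x * y) (N x * N y)%N (E x * (N y)%:Z + E y * (N x)%:Z)).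
- by rewrite intrD !intrM natrM /log addf_div ?pnatr_eq0 -?lt0n.
- by rewrite mulf_neq0.
- by rewrite muln_gt0 Nx.
have := MM _ _ (MX _ (N y) Mx) (MX _ (N x) My).
rewrite !expr_div_n -!exprM mulf_div [(N y * N x)%N]mulnC -exprMn.
by rewrite !exprnP !exprz_exp -expfzDr.
Qed.

(** * Invariant subspaces and spectra *)

Lemma char_poly_conj (R : comUnitRingType) d (P A : 'M[R]_d) :
  P \in unitmx -> char_poly (P *m A *m invmx P) = char_poly A.
Proof.
move=> uP; pose cP := map_mx (@polyC R) P; pose cP' := map_mx (@polyC R) (invmx P).
have PP' : cP *m cP' = 1%:M by rewrite -map_mxM mulmxV // map_mx1.
rewrite /char_poly /char_poly_mx !map_mxM -/cP -/cP'.
have -> : 'X%:M - cP *m map_mx polyC A *m cP' = cP *m ('X%:M - map_mx polyC A) *m cP'.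
  by rewrite mulmxBr mulmxBl scalar_mxC -(mulmxA _ cP) PP' mulmx1.
by rewrite !det_mulmx mulrAC -det_mulmx PP' det1 mul1r.
Qed.

(** [U] and [Q] present a stable subspace and the quotient by it; a change of basis
    completing [U] makes [m] block triangular. *)
Lemma char_poly_flag (K : fieldType) d r s (U : 'M[K]_(r, d)) (Q : 'M_(d, s))
    (U' : 'M_(d, r)) (Q' : 'M_(s, d)) (m : 'M_d) m1 m2 :
    (r + s)%N = d -> U *m U' = 1%:M -> Q' *m Q = 1%:M -> U *m Q = 0 ->
    U *m m = m1 *m U -> m *m Q = Q *m m2 ->
  char_poly m = char_poly m1 * char_poly m2.
Proof.
move=> Ed; case: d / Ed in U Q U' Q' m * => UU' QQ' UQ Um mQ.
pose P := col_mx U Q'.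
have uP : P \in unitmx.
  rewrite -row_free_unit -kermx_eq0; apply/eqP/row_matrixP => i.
  rewrite row0; move: (row i _) (row_sub i (kermx P)) => x /sub_kermxP.
  rewrite -[x]hsubmxK mul_row_col => Px.
  have x2 : rsubmx x = 0.
    have := congr1 (mulmx^~ Q) Px.
    by rewrite mulmxDl -!mulmxA UQ QQ' mulmx0 mulmx1 add0r mul0mx.
  move: Px; rewrite x2 mul0mx addr0 => /(congr1 (mulmx^~ U')).
  by rewrite -mulmxA UU' mulmx1 mul0mx => ->; rewrite row_mx0.
rewrite -(char_poly_conj m uP); have := mulmxKV uP (P *m m).
move: (_ *m invmx P) => B BP.
have UB : row_mx 1%:M 0 *m B = m1 *m row_mx 1%:M 0.
  have DU : U = row_mx 1%:M 0 *m P by rewrite mul_row_col mul1mx mul0mx addr0.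
  apply: (can_inj (mulmxK uP)); rewrite -(mulmxA _ B) BP -(mulmxA m1) -DU.
  by rewrite (mulmxA _ P) -DU.
have BQ : B *m col_mx 0 1%:M = col_mx 0 1%:M *m m2.
  have DQ : P *m Q = col_mx 0 1%:M by rewrite mul_col_mx UQ QQ'.
  by rewrite -DQ mulmxA BP -!mulmxA mQ.
rewrite -[B]submxK in UB BQ *.
move: (ulsubmx B) (ursubmx B) (dlsubmx B) (drsubmx B) UB BQ => Bul Bur Bdl Bdr.
rewrite mul_row_block !mul1mx !mul0mx !addr0 mul_mx_row.
rewrite mulmx1 mulmx0 => /eq_row_mx[-> ->].
rewrite mul_block_col !mulmx1 !mulmx0 !add0r mul_col_mx mul0mx mul1mx.
move=> /eq_col_mx[_ ->].
rewrite /char_poly /char_poly_mx map_block_mx map_mx0 (@scalar_mx_block _ r s).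
rewrite opp_block_mx add_block_mx oppr0 addr0 add0r.
exact: det_lblock.
Qed.

Section SubQuotient.
Variables (K : fieldType) (d : nat) (V : 'M[K]_d).
Implicit Types m n : 'M[K]_d.
Local Notation U := (row_base V).
Local Notation Q := (col_base (cokermx V)).

(** The matrices of the endomorphisms induced by [m] on the row space of [V],
    and on the quotient by it, when this row space is stable. *)
Definition sub_mx m : 'M_(\rank V) := U *m m *m pinvmx U.
Definition quo_mx m : 'M_(\rank (cokermx V)) := pinvmx Q *m m *m Q.

Lemma row_baseK : U *m pinvmx U = 1%:M.
Proof. exact/mulmxVp/row_base_free. Qed.

Lemma col_baseK : pinvmx Q *m Q = 1%:M.
Proof. exact/mulVpmx/col_base_full. Qed.

Lemma mulmx_coker0 k (x : 'M_(k, d)) : (x *m Q == 0) = (x <= V)%MS.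
Proof.
rewrite submxE -[X in _ = (_ *m X == _)]mulmx_base mulmxA.
by rewrite -(inj_eq (row_free_inj (row_base_free (cokermx V)))) mul0mx.
Qed.

Lemma row_base_coker0 : U *m Q = 0.
Proof. by apply/eqP; rewrite mulmx_coker0 eq_row_base. Qed.

Lemma sub_mx1 : sub_mx 1%:M = 1%:M.
Proof. by rewrite /sub_mx mulmx1 row_baseK. Qed.

Lemma quo_mx1 : quo_mx 1%:M = 1%:M.
Proof. by rewrite /quo_mx mulmx1 col_baseK. Qed.

Lemma sub_mxE m : stablemx V m -> U *m m = sub_mx m *m U.
Proof.
move=> stVm; rewrite mulmxKpV // eq_row_base.
by apply: submx_trans (stVm); rewrite submxMr ?eq_row_base.
Qed.

Lemma quo_mxE m : stablemx V m -> m *m Q = Q *m quo_mx m.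
Proof.
move=> stVm; apply/eqP; rewrite -subr_eq0 /quo_mx.
have -> : m *m Q - Q *m (pinvmx Q *m m *m Q) = (1%:M - Q *m pinvmx Q) *m m *m Q.
  by rewrite !mulmxBl mul1mx -!(mulmxA Q) -(mulmxA (pinvmx Q)).
rewrite mulmx_coker0.
apply: submx_trans stVm; rewrite submxMr // -mulmx_coker0.
by rewrite mulmxBl -mulmxA col_baseK mulmx1 mul1mx subrr.
Qed.

Lemma sub_mxM m n : stablemx V m -> stablemx V n ->
  sub_mx (m *m n) = sub_mx m *m sub_mx n.
Proof.
move=> stVm stVn; rewrite {1}/sub_mx (mulmxA U) sub_mxE // -(mulmxA _ U n).
by rewrite sub_mxE // (mulmxA (sub_mx m)) -(mulmxA _ U) row_baseK mulmx1.
Qed.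

Lemma quo_mxM m n : stablemx V m -> stablemx V n ->
  quo_mx (m *m n) = quo_mx m *m quo_mx n.
Proof.
move=> stVm stVn; rewrite {1}/quo_mx -(mulmxA (pinvmx Q)) -(mulmxA m n).
rewrite quo_mxE // (mulmxA m) quo_mxE // -(mulmxA Q) (mulmxA (pinvmx Q)).
by rewrite col_baseK mul1mx.
Qed.

Lemma char_poly_sub_quo m : stablemx V m ->
  char_poly m = char_poly (sub_mx m) * char_poly (quo_mx m).
Proof.
move=> stVm; have Ed : (\rank V + \rank (cokermx V))%N = d.
  by rewrite mxrank_coker subnKC // rank_leq_row.
exact: (char_poly_flag Ed row_baseK col_baseK row_base_coker0
          (sub_mxE stVm) (quo_mxE stVm)).
Qed.

End SubQuotient.

Section Spectrum.
Variable K : fieldType.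
Implicit Types (d : nat) (rs ss : seq K).

Definition spectrum d (A : 'M[K]_d) rs : Prop :=
  char_poly A = \prod_(r <- rs) ('X - r%:P).

Lemma spectrum_size d (A : 'M_d) rs : spectrum A rs -> size rs = d.
Proof.
move=> spA; have := size_char_poly A; rewrite spA.
by rewrite size_prod_XsubC => -[].
Qed.

Lemma spectrum_perm d (A : 'M_d) rs ss :
  spectrum A rs -> spectrum A ss -> perm_eq rs ss.
Proof. by move=> spr sps; apply: prod_XsubC_eq; rewrite -spr -sps. Qed.

Lemma spectrum_det d (A : 'M_d) rs : spectrum A rs -> \det A = \prod_(r <- rs) r.
Proof.
move=> spA; apply: (mulfI (x := (-1) ^+ d)); first by rewrite signr_eq0.
rewrite -char_poly_det spA -horner_coef0 horner_prod.
rewrite -(spectrum_size spA); elim: rs {spA} => [|r rs IHrs].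
  by rewrite !big_nil mulr1.
by rewrite !big_cons IHrs hornerXsubC sub0r /= exprS mulrACA mulN1r.
Qed.

Lemma spectrum_trace d (A : 'M_d) rs : spectrum A rs -> \tr A = \sum_(r <- rs) r.
Proof.
move=> spA; have Ed := spectrum_size spA; case: d => [|d] in A spA Ed *.
  by rewrite (size0nil Ed) big_nil /mxtrace big_ord0.
have := char_poly_trace A (ltn0Sn d); rewrite spA -[d.+1 in LHS]Ed.
by rewrite coefPn_prod_XsubC ?Ed // => /oppr_inj.
Qed.

Lemma spectrum_scale d (A : 'M_d) rs a :
  a != 0 -> spectrum A rs -> spectrum (a *: A) [seq a * r | r <- rs].
Proof.
move=> a_n0 spA; rewrite /spectrum /char_poly /char_poly_mx.
pose q : {poly K} := a^-1 *: 'X.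
have -> : 'X%:M - map_mx polyC (a *: A) =
    a%:P *: map_mx (fun p => p \Po q) (char_poly_mx A).
  apply/matrixP => i j; rewrite !mxE comp_polyB comp_polyC mulrBr polyCM.
  congr (_ - _); case: (i == j); rewrite ?mulr0n ?comp_poly0 ?mulr0 // !mulr1n.
  by rewrite comp_polyX mul_polyC scalerA mulfV ?scale1r.
rewrite detZ det_map_mx -/(char_poly A) spA rmorph_prod big_map /=.
rewrite -(spectrum_size spA); elim: rs {spA} => [|r rs IHrs].
  by rewrite !big_nil mulr1.
rewrite !big_cons -IHrs /= exprS mulrACA; congr (_ * _).
rewrite comp_polyB comp_polyX comp_polyC mulrBr polyCM.
by rewrite (mul_polyC a (a^-1 *: 'X)) scalerA mulfV ?scale1r.
Qed.

Lemma spectrum_scalar d (a : K) : spectrum (a%:M : 'M_d) (nseq d a).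
Proof.
rewrite /spectrum char_poly_trig ?scalar_mx_is_trig // big_nseq.
rewrite (eq_bigr (fun=> 'X - a%:P)) => [|i _]; last by rewrite mxE eqxx.
by rewrite big_const_ord.
Qed.

Lemma monic_dvd_prod (p : {poly K}) rs :
    p \is monic -> p %| \prod_(r <- rs) ('X - r%:P) ->
  exists ss, p = \prod_(r <- ss) ('X - r%:P).
Proof.
move=> p_mon /dvdp_prod_XsubC[m]; rewrite eqp_monic ?monic_prod_XsubC //.
by move=> /eqP Dp; exists (mask m rs).
Qed.

Lemma spectrum_sub_quo d (V A : 'M_d) rs : stablemx V A -> spectrum A rs ->
  exists r1 r2, [/\ spectrum (sub_mx V A) r1, spectrum (quo_mx V A) r2 &
                    perm_eq rs (r1 ++ r2)].
Proof.
move=> stVA spA; have cpA := char_poly_sub_quo stVA.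
have [||r1 sp1] := @monic_dvd_prod (char_poly (sub_mx V A)) rs.
- exact: char_poly_monic.
- by rewrite -spA cpA dvdp_mulr.
have [||r2 sp2] := @monic_dvd_prod (char_poly (quo_mx V A)) rs.
- exact: char_poly_monic.
- by rewrite -spA cpA dvdp_mull.
exists r1, r2; split=> //; apply: (spectrum_perm spA).
by rewrite /spectrum cpA sp1 sp2 big_cat.
Qed.

Lemma spectrum_cat d (V A : 'M_d) r1 r2 : stablemx V A ->
  spectrum (sub_mx V A) r1 -> spectrum (quo_mx V A) r2 -> spectrum A (r1 ++ r2).
Proof.
by move=> stVA sp1 sp2; rewrite /spectrum (char_poly_sub_quo stVA) sp1 sp2 big_cat.
Qed.

End Spectrum.

(** * Matrix representations *)

Section Representations.
Variables (G : groupType) (K : fieldType).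

Definition mx_rep d (a : G -> 'M[K]_d) : Prop :=
  a 1%g = 1%:M /\ forall x y, a (x * y)%g = a x *m a y.

Section Theory.
Variables (d : nat) (a : G -> 'M[K]_d) (aP : mx_rep a).

Lemma mx_rep1 : a 1%g = 1%:M. Proof. by case: aP. Qed.
Lemma mx_repM x y : a (x * y)%g = a x *m a y. Proof. by case: aP. Qed.

Lemma mx_repV x : a x *m a x^-1%g = 1%:M.
Proof. by rewrite -mx_repM mulgV mx_rep1. Qed.

Lemma mx_rep_det x : \det (a x) != 0.
Proof.
apply/eqP => a0; have := congr1 (fun m => \det m) (mx_repV x).
by rewrite det_mulmx a0 mul0r det1 => /eqP; rewrite eq_sym oner_eq0.
Qed.

Variable V : 'M[K]_d.
Hypothesis stV : forall x, stablemx V (a x).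

Lemma sub_rep : mx_rep (fun x => sub_mx V (a x)).
Proof.
by split=> [|x y]; rewrite ?mx_rep1 ?sub_mx1 // mx_repM sub_mxM.
Qed.

Lemma quo_rep : mx_rep (fun x => quo_mx V (a x)).
Proof.
by split=> [|x y]; rewrite ?mx_rep1 ?quo_mx1 // mx_repM quo_mxM.
Qed.

End Theory.

(** The property of the elements of the commutator subgroup that matters for
    determinants of representations. *)
Definition char_trivial (g : G) : Prop :=
  forall chi : G -> K, chi 1%g = 1 -> {morph chi : x y / (x * y)%g >-> x * y} ->
  chi g = 1.

Variables (log : K -> rat).
Hypothesis logM : forall x y, x != 0 -> y != 0 -> log (x * y) = log x + log y.

Lemma log1 : log 1 = 0.
Proof. by apply: (@addrI _ (log 1)); rewrite -logM ?oner_eq0 // mulr1 addr0. Qed.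

Lemma log_prod (rs : seq K) : 0 \notin rs ->
  log (\prod_(r <- rs) r) = \sum_(r <- rs) log r.
Proof.
elim: rs => [|r rs IHrs]; first by rewrite !big_nil log1.
rewrite inE negb_or eq_sym => /andP[r_n0 rs_n0]; rewrite !big_cons logM ?IHrs //.
by rewrite prodf_seq_neq0; apply/allP => x; apply: contraTneq => ->.
Qed.

(** Expanding the square of [log (r * s) = log r + log s] leaves a cross term for
    each eigenspace of [A], whose eigenvalue is [r]: it is twice [log r] times the
    sum of the logarithms of the eigenvalues of [b g] there, that is to say the
    logarithm of a determinant, and this determinant is 1. The proof splits off
    one eigenspace at a time, which [b] preserves as it commutes with [A]. *)
Lemma second_moment d (A : 'M[K]_d) (b : G -> 'M[K]_d) g rs ss :
    mx_rep b -> (forall x, A *m b x = b x *m A) -> char_trivial g ->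
    spectrum A rs -> 0 \notin rs -> spectrum (b g) ss ->
  exists2 ts, spectrum (A *m b g) ts &
    \sum_(t <- ts) log t ^+ 2 =
    \sum_(r <- rs) log r ^+ 2 + \sum_(s <- ss) log s ^+ 2.
Proof.
have [n] := ubnP d; elim: n d A b rs ss => // n IHn d A b rs ss lt_dn.
move=> bP Ab g1 spA rs_n0 spb; case: rs => [|r rs] in spA rs_n0 *.
  have d0 := spectrum_size spA; have s0 := spectrum_size spb.
  case: d / d0 in A b Ab bP spA spb s0 lt_dn *.
  rewrite (size0nil s0); exists [::]; last by rewrite !big_nil addr0.
  by rewrite (flatmx0 (_ *m _)) -(flatmx0 A).
pose V := eigenspace A r.
have stV B : A *m B = B *m A -> stablemx V B.
  move=> AB; apply/eigenspaceP; rewrite -mulmxA -AB mulmxA.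
  by rewrite (eigenspaceP (submx_refl V)) scalemxAl.
have stA : stablemx V A by exact: stV.
have stb x : stablemx V (b x) by exact: stV.
have V_n0 : V != 0.
  have : eigenvalue A r by rewrite eigenvalue_root_char spA root_prod_XsubC mem_head.
  by [].
have r_n0 : r != 0 by move: rs_n0; rewrite inE negb_or eq_sym => /andP[].
have subA : sub_mx V A = r%:M.
  have UA : row_base V *m A = r *: row_base V.
    by apply/eigenspaceP; rewrite eq_row_base.
  rewrite /sub_mx UA -scalemxAl row_baseK.
  by rewrite scalemx1.
have [r1 [r2 [sp1 sp2 prs]]] := spectrum_sub_quo stA spA.
have [s1 [s2 [sps1 sps2 pss]]] := spectrum_sub_quo (stb g) spb.
have [|||||||t2 spt2 Dt2] := IHn _ (quo_mx V A) (fun x => quo_mx V (b x)) r2 s2.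
- rewrite mxrank_coker -ltnS (leq_trans _ lt_dn) // ltnS ltn_subrL.
  by rewrite lt0n mxrank_eq0 V_n0 -(spectrum_size spA).
- exact: quo_rep.
- by move=> x; rewrite -!quo_mxM ?Ab.
- by [].
- by [].
- by move: rs_n0; rewrite (perm_mem prs) mem_cat negb_or => /andP[].
- by [].
have spr1 : perm_eq r1 (nseq (\rank V) r).
  by apply: (spectrum_perm sp1); rewrite subA; exact: spectrum_scalar.
exists ([seq r * s | s <- s1] ++ t2).
  apply: (@spectrum_cat _ _ V); first by apply: stV; rewrite -mulmxA Ab.
    by rewrite sub_mxM // subA mul_scalar_mx; exact: spectrum_scale.
  by rewrite quo_mxM.
have s1_n0 : 0 \notin s1.
  have := mx_rep_det (sub_rep bP stb) g; rewrite (spectrum_det sps1).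
  by rewrite prodf_seq_neq0 => /allP s1_n0; apply/negP => /s1_n0; rewrite eqxx.
have sum_s1 : \sum_(s <- s1) log s = 0.
  rewrite -log_prod // -(spectrum_det sps1).
  rewrite (g1 (fun x => \det (sub_mx V (b x)))) ?log1 //.
    by rewrite (mx_rep1 (sub_rep bP stb)) det1.
  by move=> x y; rewrite (mx_repM (sub_rep bP stb)) det_mulmx.
rewrite (perm_big _ prs) (perm_big _ pss) /= !big_cat /= Dt2 addrACA; congr (_ + _).
rewrite (perm_big _ spr1) big_map big_nseq /= iter_addr addr0 -(spectrum_size sps1).
under eq_big_seq => s s1_s.
  rewrite logM //; last by apply: contraNneq s1_n0 => <-.
  rewrite sqrrD; over.
rewrite !big_split /= -!mulr_sumr sum_s1 mulr0 !addr0.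
by rewrite big_const_seq count_predT iter_addr addr0 mulrnAr -expr2.
Qed.

End Representations.

Section QuasiUnipotent.

Definition quasi_unipotent (K : fieldType) d (A : 'M[K]_d) : Prop :=
  exists n k, (0 < n)%N /\ (A ^+ n - 1) ^+ k = 0.

Lemma map_mx_expr (K L : fieldType) (f : {rmorphism K -> L}) d (A : 'M[K]_d) n :
  map_mx f (A ^+ n) = map_mx f A ^+ n.
Proof.
by elim: n => [|n IHn]; rewrite ?map_mx1 // !exprS -!mulmxE map_mxM IHn.
Qed.

Lemma torsion_bound (K : fieldType) (rs : seq K) :
    (forall r, r \in rs -> exists2 n, (0 < n)%N & r ^+ n = 1) ->
  exists2 n, (0 < n)%N & forall r, r \in rs -> r ^+ n = 1.
Proof.
elim: rs => [|r rs IHrs] tors; first by exists 1%N.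
have [n n_gt0 nP] := IHrs (fun s rs_s => tors s (mem_behead (s := r :: rs) rs_s)).
have [m m_gt0 mP] := tors r (mem_head r rs).
exists (m * n)%N => [|s]; first by rewrite muln_gt0 m_gt0.
rewrite inE => /predU1P[->|/nP sn1]; first by rewrite exprM mP expr1n.
by rewrite mulnC exprM sn1 expr1n.
Qed.

Lemma torsion_quasi_unipotent (K : fieldType) d (A : 'M[K]_d) rs n :
    (0 < n)%N -> spectrum A rs -> (forall r, r \in rs -> r ^+ n = 1) ->
  (A ^+ n - 1) ^+ d = 0.
Proof.
move=> n_gt0 spA rsn; have div : char_poly A %| ('X^n - 1) ^+ d.
  rewrite spA -(spectrum_size spA); elim: rs rsn {spA} => [|r rs IHrs] rsn.
    by rewrite big_nil dvd1p.
  rewrite big_cons exprS dvdp_mul ?IHrs // => [|s rs_s]; last first.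
    by apply: rsn; rewrite inE rs_s orbT.
  by rewrite dvdp_XsubCl rootE !hornerE rsn ?mem_head ?subrr.
case: d => [|d] in A spA div *; first exact: flatmx0.
have /dvdpP[q Dq] := div.
have := congr1 (horner_mx A) Dq; rewrite rmorphM /= Cayley_Hamilton mulr0.
by rewrite rmorphXn rmorphB /= rmorphXn rmorph1 /= horner_mx_X.
Qed.

Lemma quasi_unipotent_spectrum (K : fieldType) d (A : 'M[K]_d) rs n k :
    (A ^+ n - 1) ^+ k = 0 -> spectrum A rs -> forall r, r \in rs -> r ^+ n = 1.
Proof.
move=> qu spA r rs_r.
have /eigenvalueP[v Av v_n0] : eigenvalue A r.
  by rewrite eigenvalue_root_char spA root_prod_XsubC.
have vX (B : 'M[K]_d) s m : v *m B = s *: v -> v *m B ^+ m = s ^+ m *: v.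
  move=> Bv; elim: m => [|m IHm]; first by rewrite !expr0 mulmx1 scale1r.
  by rewrite exprS -mulmxE mulmxA Bv -scalemxAl IHm scalerA exprS.
have vn : v *m (A ^+ n - 1) = (r ^+ n - 1) *: v.
  by rewrite mulmxBr (vX _ _ _ Av) mulmx1 scalerBl scale1r.
have := vX _ _ k vn; rewrite qu mulmx0 => /esym/eqP.
rewrite scaler_eq0 (negPf v_n0) orbF expf_eq0 => /andP[_].
by rewrite subr_eq0 => /eqP.
Qed.

(** The matrices [b g] and [A *m b g] have the same eigenvalues, hence equal
    second moments, so that the second moment of the eigenvalues of [A] is 0 and
    all their logarithms vanish, whatever the logarithm. *)
Lemma conj_mul_quasi_unipotent (G : groupType) (K : fieldType) d
    (A T : 'M[K]_d) (b : G -> 'M[K]_d) g :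
    A \in unitmx -> T \in unitmx -> mx_rep b -> (forall x, A *m b x = b x *m A) ->
    (forall L : fieldType, char_trivial L g) -> T *m b g *m invmx T = A *m b g ->
  quasi_unipotent A.
Proof.
move=> uA uT bP Ab g1 Tb.
have [|L [f [qs Dqs]]] := @splitting_ext K (char_poly A * char_poly (b g)).
  by rewrite monicMl ?char_poly_monic.
rewrite rmorphM /= !map_char_poly in Dqs.
have [||rs sprs] := @monic_dvd_prod L (char_poly (map_mx f A)) qs.
- exact: char_poly_monic.
- by rewrite -Dqs dvdp_mulr.
have [||ss spss] := @monic_dvd_prod L (char_poly (map_mx f (b g))) qs.
- exact: char_poly_monic.
- by rewrite -Dqs dvdp_mull.
have rs_n0 : 0 \notin rs.
  have := uA; rewrite -(map_unitmx f) unitmxE (spectrum_det sprs) unitfE.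
  by rewrite prodf_seq_neq0 => /allP rs_n0; apply/negP => /rs_n0; rewrite eqxx.
have [r rs_r|n n_gt0 rsn] := @torsion_bound L rs; last first.
  exists n, d; split=> //; apply: (map_mx_inj (f := f)).
  have := torsion_quasi_unipotent n_gt0 sprs rsn.
  by rewrite map_mx_expr map_mxB map_mx1 map_mx_expr map_mx0.
apply: contrapT => r_inf.
have [||log log_r logM] := @log_exists L r.
- by apply: contraNneq rs_n0 => <-.
- by move=> n n_gt0; apply/eqP => rn1; apply: r_inf; exists n.
have [||||||ts spts Dts] := @second_moment G L log logM d (map_mx f A)
    (fun x => map_mx f (b x)) g rs ss.
- by split=> [|x y]; rewrite ?(mx_rep1 bP) ?map_mx1 // (mx_repM bP) map_mxM.
- by move=> x; rewrite -!map_mxM Ab.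
- exact: g1.
- by [].
- by [].
- by [].
have : perm_eq ts ss.
  apply: (spectrum_perm spts); rewrite /spectrum -map_mxM -Tb -map_char_poly.
  by rewrite char_poly_conj // map_char_poly.
move=> /(perm_big _) /= Ets; move: Dts; rewrite Ets.
move=> /(congr1 (fun x => x - \sum_(s <- ss) log s ^+ 2)).
rewrite subrr addrK => /esym/eqP; rewrite psumr_eq0 => [/allP/(_ r rs_r)|s _].
  by rewrite /= sqrf_eq0 (negPf log_r).
exact: sqr_ge0.
Qed.

End QuasiUnipotent.

(** In characteristic [p], raising [A ^ n = 1 + nilpotent] to a large power of [p]
    kills the nilpotent part. *)
Lemma quasi_unipotent_pchar (K : fieldType) d (A : 'M[K]_d) p :
  p \in [pchar K] -> quasi_unipotent A -> exists2 n, (0 < n)%N & A ^+ n = 1.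
Proof.
move=> pK [n [k [n_gt0 Ank]]]; case: d => [|d] in A Ank *.
  by exists 1%N => //; rewrite [LHS]flatmx0 [RHS]flatmx0.
have pM : p \in [pchar 'M[K]_d.+1] by rewrite pchar_lalg.
have p_gt1 := prime_gt1 (pcharf_prime pK).
have FrobX j : (A ^+ n - 1) ^+ (p ^ j) = A ^+ (n * p ^ j) - 1.
  elim: j => [|j IHj]; first by rewrite expn0 muln1 expr1.
  rewrite expnSr exprM IHj -(pFrobenius_autE pM).
  rewrite pFrobenius_autB_comm; last exact: commr1.
  by rewrite pFrobenius_aut1 pFrobenius_autE -exprM mulnA.
exists (n * p ^ k)%N; first by rewrite muln_gt0 n_gt0 expn_gt0 ltnW.
apply/eqP; rewrite -subr_eq0 -FrobX.
by rewrite -(subnK (ltnW (ltn_expl k p_gt1))) exprD Ank mulr0.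
Qed.

(** * Sums of roots of unity *)

Section TorsionSums.
Variable L : fieldType.
Implicit Types (x y : L) (C : nat).

Definition torsion_sum C x : Prop := exists zs : seq L,
  [/\ (size zs <= C)%N, forall z, z \in zs -> exists2 n, (0 < n)%N & z ^+ n = 1 &
      x = \sum_(z <- zs) z].

Lemma torsion_sum0 : torsion_sum 0 0.
Proof. by exists [::]; rewrite big_nil. Qed.

Lemma torsion_sumD C C' x y :
  torsion_sum C x -> torsion_sum C' y -> torsion_sum (C + C') (x + y).
Proof.
move=> [zs [zsC zs1 ->]] [ts [tsC ts1 ->]]; exists (zs ++ ts).
rewrite size_cat leq_add // big_cat; split=> // z.
by rewrite mem_cat => /orP[/zs1|/ts1].
Qed.

Lemma torsion_sumMn C x m : torsion_sum C x -> torsion_sum (m * C) (x *+ m).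
Proof.
move=> xC; elim: m => [|m IHm]; first exact: torsion_sum0.
by rewrite mulSn mulrS; apply: torsion_sumD.
Qed.

Lemma torsion_sumN C x : torsion_sum C x -> torsion_sum C (- x).
Proof.
move=> [zs [zsC zs1 ->]]; exists (map -%R zs).
rewrite size_map big_map sumrN; split=> // _ /mapP[z /zs1[n n_gt0 zn] ->].
exists (n * 2)%N; first by rewrite muln_gt0 n_gt0.
by rewrite mulnC exprM sqrrN -exprM mulnC exprM zn expr1n.
Qed.

Lemma torsion_sum_sign C x i : torsion_sum C x -> torsion_sum C ((-1) ^+ i * x).
Proof.
move=> xC; rewrite -signr_odd; case: (odd i); rewrite ?mul1r // mulN1r.
exact: torsion_sumN.
Qed.

Lemma torsion_sum_sum n (C : nat -> nat) (F : nat -> L) :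
  (forall i, (i < n)%N -> torsion_sum (C i) (F i)) ->
  torsion_sum (\sum_(i < n) C i) (\sum_(i < n) F i).
Proof.
elim: n => [|n IHn] CF; first by rewrite !big_ord0; exact: torsion_sum0.
rewrite !big_ord_recr /=; apply: torsion_sumD; last exact: CF.
by apply: IHn => i lt_in; apply/CF/ltnW.
Qed.

Lemma torsion_sum_integral C x :
  torsion_sum C x -> integralOver (intr : int -> L) x.
Proof.
move=> [zs [_ zs1 ->]]; elim: zs zs1 => [|z zs IHzs] zs1.
  by rewrite big_nil; apply: integral0.
rewrite big_cons; apply: integral_add; last first.
  by apply: IHzs => t zs_t; apply: zs1; rewrite inE zs_t orbT.
have [n n_gt0 zn] := zs1 z (mem_head z zs).
exists ('X^n - 1); first by rewrite monicXnsubC // polyC1.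
by rewrite rmorphB /= map_polyXn rmorph1 rootE !hornerE zn subrr.
Qed.

End TorsionSums.

Lemma pchar0_intr_inj (K : fieldType) :
  [pchar K] =i pred0 -> injective (intr : int -> K).
Proof.
move/pcharf0P => K0; apply: raddf_inj => -[] n n0.
  have : n%:R == 0 :> K by apply/eqP; exact: n0.
  by rewrite K0 => /eqP ->.
have : n.+1%:R == 0 :> K by rewrite -oppr_eq0; apply/eqP; exact: n0.
by rewrite K0.
Qed.

Lemma pchar0_ext (K L : fieldType) (f : {rmorphism K -> L}) :
  [pchar K] =i pred0 -> [pchar L] =i pred0.
Proof. by move=> K0 p; rewrite (fmorph_pchar f). Qed.

(** In characteristic 0 the polynomial [X ^ n - 1] is separable, so that once it
    splits its roots form a cyclic group of order [n]. *)
Lemma torsion_common_root (L : fieldType) (zs : seq L) :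
    [pchar L] =i pred0 ->
    (forall z, z \in zs -> exists2 n, (0 < n)%N & z ^+ n = 1) ->
  exists (M : fieldType) (g : {rmorphism L -> M}) (x : M) (n : nat),
    [/\ (0 < n)%N, x ^+ n = 1 & forall z, z \in zs -> exists i, g z = x ^+ i].
Proof.
move=> L0 /torsion_bound[n n_gt0 zsn].
have [|M [g [rs Drs]]] := @splitting_ext L ('X^n - 1).
  by rewrite -polyC1 monicXnsubC.
rewrite rmorphB /= map_polyXn rmorph1 in Drs.
have n_n0 : n%:R != 0 :> M.
  by have /pcharf0P -> := pchar0_ext g L0; rewrite -lt0n.
have rs1 : all n.-unity_root rs.
  by apply/allP => r; rewrite -root_prod_XsubC -Drs.
have rs_uniq : uniq rs.
  by rewrite -separable_prod_XsubC -Drs separable_Xn_sub_1.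
have rs_size : (n <= size rs)%N.
  by rewrite -ltnS -(size_prod_XsubC rs id) -Drs -polyC1 size_XnsubC.
have /hasP[x _ x_prim] := has_prim_root n_gt0 rs1 rs_uniq rs_size.
exists M, g, x, n; split=> // [|z /zsn zn]; first exact: prim_expr_order.
have [|i ->] := prim_rootP x_prim (x := g z); last by exists i.
by rewrite -rmorphXn zn rmorph1.
Qed.

Lemma min_int_annihilator (M : fieldType) (x : M) (q : {poly int}) :
    q != 0 -> root (map_poly intr q) x ->
  exists r : {poly int}, [/\ r != 0, root (map_poly intr r) x &
    forall p, p != 0 -> root (map_poly intr p) x -> (size r <= size p)%N].
Proof.
move=> q_n0 qx; pose P m := `[< exists r : {poly int},
  [/\ r != 0, root (map_poly intr r) x & size r = m] >].
have exP : exists m, P m by exists (size q); apply/asboolP; exists q.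
case: (ex_minnP exP) => m /asboolP[r [r_n0 rx <-{m}]] r_min.
by exists r; split=> // p p_n0 px; apply: r_min; apply/asboolP; exists p.
Qed.

(** The image of [x] in the complex numbers is a root of a relation of [x] of
    least degree: pseudo-division by this relation reduces any other one to 0. *)
Lemma complex_specialization (M : fieldType) (x : M) (q : {poly int}) :
    [pchar M] =i pred0 -> q != 0 -> root (map_poly intr q) x ->
  exists z : algC, forall p : {poly int},
    root (map_poly intr p) x -> root (map_poly intr p) z.
Proof.
move=> M0 q_n0 qx; have [r [r_n0 rx r_min]] := min_int_annihilator q_n0 qx.
have rz : size (map_poly (intr : int -> algC) r) != 1%N.
  rewrite size_map_inj_poly ?rmorph0 //; last exact: intr_inj.
  apply: contraTneq rx => r1; have [c c_n0 Dr] := size_poly1P _ (introT eqP r1).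
  rewrite Dr map_polyC rootC /=; apply: contra c_n0 => /eqP c0.
  by apply/eqP/(pchar0_intr_inj M0); rewrite c0.
have /closed_rootP[z zr] := rz; exists z => p px.
have Dp := Pdiv.Idomain.divp_eq p r.
have rem0 : p %% r = 0.
  apply/eqP/negPn/negP => rem_n0.
  suff /(r_min _ rem_n0) : root (map_poly intr (p %% r)) x.
    by rewrite leqNgt ltn_modp r_n0.
  have := congr1 (fun q => (map_poly (intr : int -> M) q).[x]) Dp.
  rewrite map_polyZ rmorphD rmorphM /= !hornerE (rootP px) (rootP rx) !mulr0 add0r.
  by move=> /esym/rootP.
have := congr1 (fun q => (map_poly (intr : int -> algC) q).[z]) Dp.
rewrite rem0 addr0 map_polyZ rmorphM /= !hornerE (rootP zr) mulr0 => /eqP.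
rewrite mulf_eq0 => /orP[|//]; rewrite intr_eq0 expf_eq0 lead_coef_eq0 (negPf r_n0).
by rewrite andbF.
Qed.

Lemma horner_intr_wide (R : comNzRingType) (p : {poly int}) n (t : R) :
  (size p <= n)%N -> (map_poly intr p).[t] = \sum_(i < n) (p`_i)%:~R * t ^+ i.
Proof.
move=> le_pn; rewrite (@horner_coef_wide _ n) ?(leq_trans (size_poly _ _)) //.
by apply: eq_bigr => i _; rewrite coef_map.
Qed.

(** The relation satisfied by [N * t] when [q] is a relation of [t], without
    denominators. *)
Definition dilate_poly (N : nat) (q : {poly int}) : {poly int} :=
  \poly_(i < size q) (q`_i * N%:R ^+ (size q - i)).

Lemma horner_dilate (R : comNzRingType) N (q : {poly int}) (t : R) :
  (map_poly intr (dilate_poly N q)).[N%:R * t] =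
  N%:R ^+ size q * (map_poly intr q).[t].
Proof.
rewrite (@horner_intr_wide _ (dilate_poly N q) (size q)) ?size_poly //.
rewrite (@horner_intr_wide _ q (size q)) // mulr_sumr; apply: eq_bigr => i _.
rewrite coef_poly ltn_ord rmorphM rmorphXn rmorph_nat.
have -> : N%:R ^+ size q = N%:R ^+ (size q - i) * N%:R ^+ i :> R.
  by rewrite -exprD subnK // ltnW.
by rewrite exprMn [RHS]mulrACA; congr (_ * _); exact: mulrC.
Qed.

Lemma torsion_poly (M : fieldType) (x : M) (zs : seq M) :
    (forall z, z \in zs -> exists i, z = x ^+ i) ->
  exists S : {poly int}, (map_poly intr S).[x] = \sum_(z <- zs) z /\
    forall z : algC, `|z| = 1 -> `|(map_poly intr S).[z]| <= (size zs)%:R.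
Proof.
elim: zs => [|z zs IHzs] zsx.
  by exists 0; split=> [|z _]; rewrite rmorph0 horner0 ?big_nil // normr0.
have [|S [Sx Sle]] := IHzs; first by move=> t zs_t; apply: zsx; rewrite inE zs_t orbT.
have [i Dz] := zsx z (mem_head z zs); exists ('X^i + S); split=> [|t t1].
  by rewrite rmorphD /= map_polyXn big_cons !hornerE Sx Dz.
rewrite rmorphD /= map_polyXn !hornerE (le_trans (ler_normD _ _)) //.
by rewrite normrX t1 expr1n /= -natr1 addrC lerD2r Sle.
Qed.

(** Specialize roots of unity to complex numbers of absolute value 1: for each
    [s], some complex root of a fixed integral relation [q] of [x] has absolute
    value at most [C / s ^ e]. As [s] grows this forces [q] to vanish at 0, which
    is impossible if [q] has least degree and [x != 0]. *)
Lemma torsion_multiples (K : fieldType) (x : K) C e :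
    [pchar K] =i pred0 -> (0 < e)%N ->
    (forall s, (0 < s)%N -> exists (L : fieldType) (f : {rmorphism K -> L}),
       torsion_sum C (f ((s ^ e)%:R * x))) ->
  x = 0.
Proof.
move=> K0 e_gt0 sx; apply/eqP/negPn/negP => x_n0.
have intr_map (L : fieldType) (f : {rmorphism K -> L}) (p : {poly int}) t :
    (map_poly intr p).[f t] = f (map_poly intr p).[t].
  rewrite -horner_map -map_poly_comp; congr (_.[_]).
  by apply: eq_map_poly => m /=; rewrite rmorph_int.
have [q [q_n0 qx q_min]] : exists q : {poly int},
    [/\ q != 0, root (map_poly intr q) x &
    forall p, p != 0 -> root (map_poly intr p) x -> (size q <= size p)%N].
  have [L [f]] := sx 1%N isT.
  rewrite exp1n mul1r => /torsion_sum_integral[p p_mon px].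
  apply: (@min_int_annihilator _ _ p); first exact: monic_neq0.
  by move: px; rewrite !rootE intr_map fmorph_eq0.
have q0_n0 : q`_0 != 0.
  apply/eqP => q0; have /factor_theorem[r] : root q 0 by rewrite rootE horner_coef0 q0.
  rewrite subr0 => Dq; have r_n0 : r != 0.
    by apply: contraNneq q_n0 => r0; rewrite Dq r0 mul0r.
  suff /(q_min _ r_n0) : root (map_poly intr r) x by rewrite Dq size_mulX // ltnn.
  move: qx.
  by rewrite Dq rmorphM /= map_polyX rootM rootX (negPf x_n0) orbF.
(* [B] bounds [q.[w] - q.[0]] by [B * `|w|] on the unit disk. *)
pose B : nat := \sum_(i < size q) absz (q`_i)%R.
pose s := (C * B + C).+1; pose N := (s ^ e)%N.
have N_gt0 : (0 < N)%N by rewrite expn_gt0.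
have le_sN : (s <= N)%N by rewrite -{1}[s]expn1 leq_pexp2l.
have [L [f [zs [zsC zs1 Dzs]]]] := sx s isT; rewrite -/N in Dzs.
have L0 := pchar0_ext f K0.
have [M [g [y [n [n_gt0 yn zsy]]]]] := torsion_common_root L0 zs1.
have M0 := pchar0_ext g L0.
have [|S [Sy Sle]] := @torsion_poly M y (map g zs).
  by move=> _ /mapP[z zs_z ->]; apply: zsy.
rewrite big_map -rmorph_sum -Dzs /= in Sy.
have [||z zP] := @complex_specialization M y ('X^n - 1) M0.
- by rewrite -polyC1 monic_neq0 // monicXnsubC.
- by rewrite rmorphB /= map_polyXn rmorph1 rootE !hornerE yn subrr.
have zn : z ^+ n = 1.
  have := zP ('X^n - 1); rewrite !rmorphB /= !map_polyXn !rmorph1.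
  rewrite !rootE !hornerE yn subrr eqxx.
  by move=> /(_ isT); rewrite subr_eq0 => /eqP.
have z1 : `|z| = 1.
  by apply/eqP; rewrite -(@pexpr_eq1 _ _ n) // -normrX zn normr1.
have N_n0 : N%:R != 0 :> algC by rewrite pnatr_eq0 -lt0n.
pose w : algC := (map_poly intr S).[z] / N%:R.
have w_le : `|w| <= C%:R / N%:R.
  rewrite /w normf_div normr_nat ler_pM2r ?invr_gt0 ?ltr0n //.
  by rewrite (le_trans (Sle z z1)) // size_map ler_nat.
have w_le1 : `|w| <= 1.
  rewrite (le_trans w_le) // ler_pdivrMr ?ltr0n // mul1r ler_nat.
  by rewrite (leq_trans _ le_sN) // leqW // leq_addl.
have qw : (map_poly intr q).[w] = 0.
  apply: (mulfI (x := N%:R ^+ size q)); first by rewrite expf_neq0.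
  rewrite mulr0 -horner_dilate /w mulrCA mulfV // mulr1.
  have := zP (dilate_poly N q \Po S); rewrite !map_comp_poly /= !rootE !horner_comp Sy.
  rewrite rmorphM rmorphM /= !rmorph_nat horner_dilate.
  rewrite -[g (f x)]/((g \o f : {rmorphism K -> M}) x) intr_map (rootP qx).
  rewrite rmorph0 mulr0 eqxx.
  by move=> /(_ isT)/eqP.
have q_gt0 : (0 < size q)%N by rewrite size_poly_gt0.
have := qw; rewrite (@horner_intr_wide _ q (size q)) //.
have := erefl B; rewrite {1}/B; case: (size q) q_gt0 => // k _.
rewrite !big_ord_recl /= expr0 mulr1 => DB /eqP; rewrite addr_eq0 => /eqP Dq0.
have : 1 <= `|w| * B%:R.
  apply: (@le_trans _ _ `|(q`_0)%:~R|).
    by rewrite -intr_norm -[1]/(1%:~R) ler_int -gtz0_ge1 normr_gt0.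
  rewrite Dq0 normrN (le_trans (ler_norm_sum _ _ _)) // -DB natrD mulrDr.
  rewrite -[leLHS]add0r lerD ?mulr_ge0 // natr_sum mulr_sumr ler_sum // => i _.
  rewrite normrM mulrC ler_pM // ?normrX.
    by rewrite /bump /= add1n exprS ler_piMr // exprn_ile1.
  by rewrite -intr_norm pmulrn abszE.
apply/negP; rewrite -real_ltNge ?realE ?mulr_ge0 ?ler01 //.
apply: (@le_lt_trans _ _ (C%:R / N%:R * B%:R)).
  by rewrite ler_wpM2r.
rewrite mulrAC ltr_pdivrMr ?ltr0n // mul1r -natrM ltr_nat (leq_trans _ le_sN) //.
by rewrite ltnS leq_addr.
Qed.

Section QuasiUnipotentRep.
Variables (S : groupType) (K : fieldType) (K0 : [pchar K] =i pred0).

Lemma mx_repX d (a : S -> 'M[K]_d) x n : mx_rep a -> a (x ^+ n)%g = a x ^+ n.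
Proof.
move=> aP; elim: n => [|n IHn]; first by rewrite mx_rep1.
by rewrite expgS (mx_repM aP) IHn exprS.
Qed.

Lemma horner_mx_coef d (n : 'M[K]_d.+1) (p : {poly K}) m : (size p <= m)%N ->
  horner_mx n p = \sum_(j < m) p`_j *: n ^+ j.
Proof.
move=> le_pm; have {1}-> : p = \poly_(j < m) p`_j.
  apply/polyP => j; rewrite coef_poly; case: ltnP => // le_mj.
  by rewrite nth_default // (leq_trans le_pm).
rewrite poly_def rmorph_sum; apply: eq_bigr => j _ /=.
by rewrite horner_mxZ rmorphXn /= horner_mx_X.
Qed.

Lemma quasi_unipotent_trace (L : fieldType) (f : {rmorphism K -> L}) d
    (A : 'M[K]_d) ps :
    quasi_unipotent A -> map_poly f (char_poly A) %| \prod_(r <- ps) ('X - r%:P) ->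
  torsion_sum d (f (\tr A)).
Proof.
move=> [n [k [n_gt0 Ank]]]; rewrite map_char_poly => div.
have [rs sprs] := monic_dvd_prod (char_poly_monic _) div.
have Lnk : (map_mx f A ^+ n - 1) ^+ k = 0.
  by rewrite -[RHS](map_mx0 f) -Ank map_mx_expr map_mxB map_mx1 map_mx_expr.
exists rs; split=> [|r rs_r|]; first by rewrite (spectrum_size sprs).
  by exists n => //; apply: (quasi_unipotent_spectrum Lnk sprs).
by rewrite -(spectrum_trace sprs) trace_map_mx.
Qed.

(** The function [s |-> tr (a h * a g ^ s)] is polynomial, and takes values that
    are sums of boundedly many roots of unity: it is constant. *)
Lemma trace_unipotent d (a : S -> 'M[K]_d) g h k :
    mx_rep a -> (forall x, quasi_unipotent (a x)) -> (a g - 1) ^+ k = 0 ->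
  \tr (a h *m (a g - 1)) = 0.
Proof.
move=> aP aQ; case: d => [|d] in a aP aQ * => [_|]; first by rewrite /mxtrace big_ord0.
set n := a g - 1 => nk0; pose t i := \tr (a h *m n ^+ i).
apply/eqP/negPn/negP => t1.
have ex_t : exists i, t i != 0 by exists 1%N; rewrite /t expr1.
have t_le i : t i != 0 -> (i <= k)%N.
  move=> ti; rewrite leqNgt; apply: contra ti => lt_ki.
  by rewrite /t -(subnK (ltnW lt_ki)) exprD nk0 mulr0 mulmx0 mxtrace0.
case: (ex_maxnP ex_t t_le) => e te e_max.
have e_gt0 : (0 < e)%N by apply: e_max; rewrite /t expr1.
have t0 j : (e < j)%N -> t j = 0.
  by move=> lt_ej; apply/eqP/negPn/negP => /e_max; rewrite leqNgt lt_ej.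
(* [t e] is the last nonzero trace: [a g ^ s - 1] is [n] times a polynomial in [n]
   with constant term [s], and only the term of degree [e] of its [e]-th power
   contributes to the trace. *)
have Dt s : (s ^ e)%:R * t e = \tr (a h *m (a g ^+ s - 1) ^+ e).
  pose q : {poly K} := \sum_(j < s) ('X + 1) ^+ j.
  have -> : a g ^+ s - 1 = n * horner_mx n q.
    rewrite subrX1 -/n; congr (_ * _); rewrite rmorph_sum; apply: eq_bigr => j _.
    by rewrite rmorphXn rmorphD /= horner_mx_X rmorph1 subrK.
  have nq : GRing.comm n (horner_mx n q).
    have := congr1 (horner_mx n) (mulrC 'X q); rewrite !rmorphM /= horner_mx_X; exact.
  rewrite exprMn_comm // -rmorphXn /= (horner_mx_coef _ (leqnSn _)).
  rewrite [n ^+ e * _]mulr_sumr mulmx_sumr raddf_sum /=.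
  have q0 : (q ^+ e)`_0 = (s ^ e)%:R.
    rewrite -horner_coef0 !hornerE horner_sum natrX; congr (_ ^+ _).
    under eq_bigr => j _ do rewrite horner_exp !hornerE ?add0r expr1n.
    by rewrite sumr_const card_ord.
  rewrite big_ord_recl big1 ?addr0 => [|j _].
    by rewrite expr0 q0 -scalerAr mulr1 -scalemxAr mxtraceZ.
  rewrite -scalerAr -exprD -scalemxAr mxtraceZ -/(t _) t0 ?mulr0 //.
  by rewrite addnS ltnS leq_addr.
move: te; apply/negP; rewrite negbK; apply/eqP.
pose C := (\sum_(i < e.+1) 'C(e, i) * d.+1)%N.
apply: (torsion_multiples (C := C) K0 e_gt0) => s s_gt0.
(* The binomial expansion of [(a g ^ s - 1) ^ e] involves the traces of [a (y i)]. *)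
pose y i := (h * g ^+ (s * (e - i)))%g.
pose p := \prod_(i < e.+1) char_poly (a (y i)).
have p_mon : p \is monic by apply: monic_prod => i _; apply: char_poly_monic.
have [L [f [ps Dps]]] := splitting_ext p_mon.
exists L, f; rewrite Dt exprBn_comm; last exact: commr1.
rewrite mulmx_sumr [\tr _]raddf_sum rmorph_sum /=.
apply: (@torsion_sum_sum L e.+1 (fun i => 'C(e, i) * d.+1)%N (fun i =>
  f (\tr (a h *m ((-1) ^+ i * (a g ^+ s) ^+ (e - i) * 1 ^+ i *+ 'C(e, i)))))).
move=> i lt_ie.
have tsy : torsion_sum d.+1 (f (\tr (a (y i)))).
  apply: (@quasi_unipotent_trace L f _ _ ps); first exact: aQ.
  by rewrite -Dps dvdp_map /p (bigD1 (Ordinal lt_ie)) //= dvdp_mulr.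
have -> : \tr (a h *m ((-1) ^+ i * (a g ^+ s) ^+ (e - i) * 1 ^+ i *+ 'C(e, i))) =
    ((-1) ^+ i * \tr (a (y i))) *+ 'C(e, i).
  rewrite expr1n mulr1 /y (mx_repM aP) (mx_repX _ _ aP) -exprM.
  rewrite -scaler_nat -scalemxAr mxtraceZ mulr_natl.
  rewrite -(signr_odd K) -(signr_odd 'M[K]_d.+1); congr (_ *+ _).
  by case: (odd i); rewrite /= ?expr1 ?expr0 !(mulN1r, mul1r) // mulmxN raddfN.
by rewrite rmorphMn rmorphM rmorph_sign; apply/torsion_sumMn/torsion_sum_sign.
Qed.

End QuasiUnipotentRep.

(** An upper bound of least rank is a least upper bound, since upper bounds are
    stable under intersection. *)
Lemma mx_sup (K : fieldType) d (P : 'M[K]_d -> Prop) : exists V : 'M[K]_d,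
  (forall m, P m -> (m <= V)%MS) /\
  forall N : 'M[K]_d, (forall m, P m -> (m <= N)%MS) -> (V <= N)%MS.
Proof.
pose ub (N : 'M[K]_d) := forall m, P m -> (m <= N)%MS.
have ex_ub : exists k, `[< exists2 N, ub N & \rank N = k >].
  exists (\rank (1%:M : 'M[K]_d)); apply/asboolP; exists 1%:M => // m _.
  exact: submx1.
case: (ex_minnP ex_ub) => k /asboolP[V ubV <-{k}] V_min; exists V; split=> // N ubN.
have le_cap : (V :&: N <= V)%MS by apply: capmxSl.
have ub_cap : ub (V :&: N)%MS by move=> m Pm; rewrite sub_capmx ubV // ubN.
rewrite (submx_trans _ (capmxSr V N)) // -(geq_leqif (mxrank_leqif_sup le_cap)).
by apply: V_min; apply/asboolP; exists (V :&: N)%MS.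
Qed.

(** By the Cayley-Hamilton theorem, the determinant of [Q] times the trace [r] of
    the identity is a combination of traces of positive powers of [Q]. *)
Lemma trace_powers_unit (K : fieldType) r (Q : 'M[K]_r) :
    [pchar K] =i pred0 -> (0 < r)%N -> (forall k, \tr (Q ^+ k.+1) = 0) ->
  Q \notin unitmx.
Proof.
move=> K0; case: r => // r in Q * => _ trQ; apply/negP => uQ.
have := congr1 (@mxtrace _ _) (Cayley_Hamilton Q).
rewrite (horner_mx_coef _ (leqnSn _)) big_ord_recl mxtraceD mxtraceZ expr0 mxtrace1.
rewrite raddf_sum big1 /= => [|j _]; last by rewrite mxtraceZ trQ mulr0.
rewrite addr0 char_poly_det mxtrace0 => /eqP; rewrite !mulf_eq0 signr_eq0 /=.
have /pcharf0P-> := K0; rewrite orbF.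
by move: uQ; rewrite unitmxE unitfE => /negPf->.
Qed.

Section Reducibility.
Variables (S : groupType) (K : fieldType) (K0 : [pchar K] =i pred0).
Variables (d : nat) (a : S -> 'M[K]_d) (aP : mx_rep a).

Inductive in_span : 'M[K]_d -> Prop :=
| SpanRep x : in_span (a x)
| SpanD m n : in_span m -> in_span n -> in_span (m + n)
| SpanZ c m : in_span m -> in_span (c *: m).

Lemma in_spanM m n : in_span m -> in_span n -> in_span (m *m n).
Proof.
move=> Sm Sn; elim: Sm => [x|m1 m2 _ IH1 _ IH2|c m1 _ IHm].
- elim: Sn => [y|n1 n2 _ IH1 _ IH2|c n1 _ IHn].
  + by rewrite -(mx_repM aP); apply: SpanRep.
  + by rewrite mulmxDr; apply: SpanD.
  + by rewrite -scalemxAr; apply: SpanZ.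
- by rewrite mulmxDl; apply: SpanD.
- by rewrite -scalemxAl; apply: SpanZ.
Qed.

Lemma in_spanX m k : in_span m -> in_span (m ^+ k).
Proof.
move=> Sm; elim: k => [|k IHk]; first by have := SpanRep 1%g; rewrite (mx_rep1 aP).
by rewrite exprS; apply: in_spanM.
Qed.

(** The radical of the trace form. *)
Definition in_radical m : Prop := in_span m /\ forall x, \tr (m *m a x) = 0.

Lemma radical_trace m n : in_radical m -> in_span n -> \tr (m *m n) = 0.
Proof.
move=> [_ m0]; elim=> [x|n1 n2 _ IH1 _ IH2|c n1 _ IHn]; first exact: m0.
  by rewrite mulmxDr mxtraceD IH1 IH2 addr0.
by rewrite -scalemxAr mxtraceZ IHn mulr0.
Qed.

(** Take [n0] of least rank among the nonzero elements of the radical. If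
    [n0 *m a x *m n0] were not 0, it would have the same rank, and then [a x *m n0]
    would induce an invertible endomorphism [Q] of the image of [n0]; but all the
    positive powers of [Q] have trace 0. *)
Lemma radical_min_rank n : in_radical n -> n != 0 ->
  exists n0, [/\ in_radical n0, n0 != 0 & forall x, n0 *m a x *m n0 = 0].
Proof.
move=> Rn n_n0; pose P k := `[< exists m, [/\ in_radical m, m != 0 & \rank m = k] >].
have exP : exists k, P k by exists (\rank n); apply/asboolP; exists n.
case: (ex_minnP exP) => k /asboolP[n0 [Rn0 n0_n0 <-{k}]] n0_min.
exists n0; split=> // x; apply/eqP/negPn/negP => nxn.
have [C [W Dn0]] : exists (C : 'M_(d, \rank n0)) (W : 'M_(\rank n0, d)), C *m W = n0.
  by exists (col_base n0), (row_base n0); exact: mulmx_base.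
pose Q := W *m a x *m C.
have Dnxn : n0 *m a x *m n0 = C *m Q *m W.
  by rewrite /Q -!mulmxA Dn0 !mulmxA Dn0.
have Sx := SpanRep x; have [Sn0 _] := Rn0.
have uQ : Q \in unitmx.
  rewrite -row_free_unit /row_free eqn_leq rank_leq_row /=.
  have /n0_min le_r : P (\rank (n0 *m a x *m n0)).
    apply/asboolP; exists (n0 *m a x *m n0); split=> //; split.
      by do 2?apply: in_spanM.
    move=> y; rewrite -!mulmxA; apply: radical_trace => //.
    by do 2?apply: in_spanM => //; apply: SpanRep.
  apply: (leq_trans le_r); rewrite Dnxn.
  by apply: leq_trans (mxrankM_maxl _ _) _; apply: mxrankM_maxr.
move: uQ; apply/negP; apply: trace_powers_unit => // [|k].
  by rewrite lt0n mxrank_eq0.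
have -> : Q ^+ k.+1 = W *m (a x *m n0) ^+ k *m (a x *m C).
  rewrite -[X in (a x *m X) ^+ _]Dn0; elim: k => [|k IHk].
    by rewrite expr1 mulmx1 mulmxA.
  by rewrite exprS IHk -!mulmxE exprS -!mulmxE /Q !mulmxA.
rewrite -mulmxA mxtrace_mulC -!mulmxA Dn0 mulmxA mxtrace_mulC.
by apply: radical_trace => //; apply: in_spanM => //; apply/in_spanX/in_spanM.
Qed.

(** The rows of the matrices [n *m a x], for [n] as in [radical_min_rank], span a
    stable subspace that is killed by [n]. *)
Lemma unipotent_reducible g k :
    (forall x, quasi_unipotent (a x)) -> (a g - 1) ^+ k = 0 -> a g != 1%:M ->
  exists V : 'M[K]_d, [/\ forall x, stablemx V (a x), V != 0 & ~~ row_full V].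
Proof.
move=> aQ gk g_n1; have Rg : in_radical (a g - 1).
  split=> [|x]; last by rewrite mxtrace_mulC (trace_unipotent K0 x aP aQ gk).
  have := SpanD (SpanRep g) (SpanZ (-1) (SpanRep 1%g)).
  by rewrite (mx_rep1 aP) scaleN1r.
have [|n [_ n_n0 nan]] := radical_min_rank Rg; first by rewrite subr_eq0.
have [V [ubV V_min]] := mx_sup (fun m => exists x, m = n *m a x).
have unit_a x : a x *m a x^-1%g = 1%:M by apply: mx_repV.
exists V; split=> [x||].
- have sV : (V <= V *m a x^-1%g)%MS.
    apply: V_min => _ [y ->]; rewrite -(mulgK x y) (mx_repM aP) mulmxA submxMr //.
    by apply: ubV; exists (y * x)%g.
  have := submxMr (a x) sV.
  by rewrite -mulmxA -(mx_repM aP) mulVg (mx_rep1 aP) mulmx1.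
- apply: contraNneq n_n0 => V0; rewrite -submx0 -V0; apply: ubV.
  by exists 1%g; rewrite (mx_rep1 aP) mulmx1.
apply: contra n_n0 => Vfull; have sVk : (V <= kermx n)%MS.
  by apply: V_min => _ [x ->]; apply/sub_kermxP; apply: nan.
move: sVk; rewrite sub_kermx => /eqP Vn0.
by rewrite -(inj_eq (row_full_inj Vfull)) Vn0 mulmx0.
Qed.

End Reducibility.

(** * Solvability *)

Section IteratedCommutators.
Variables (S : groupType).

Fixpoint iter_commutator (U : S -> Prop) k (x : S) : Prop :=
  if k is k'.+1 then exists y z,
    [/\ iter_commutator U k' y, iter_commutator U k' z & x = [~ y, z]%g]
  else U x.

Lemma iter_commutator_sub (U U' : S -> Prop) k x :
  (forall y, U y -> U' y) -> iter_commutator U k x -> iter_commutator U' k x.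
Proof.
move=> sUU'; elim: k x => [|k IHk] x /=; first exact: sUU'.
by move=> [y [z [Uy Uz ->]]]; exists y, z; split=> //; apply: IHk.
Qed.

Lemma iter_commutatorJ (U : S -> Prop) k x s :
    (forall y, U y -> U (y ^ s)%g) ->
  iter_commutator U k x -> iter_commutator U k (x ^ s)%g.
Proof.
move=> UJ; elim: k x => [|k IHk] x /=; first exact: UJ.
move=> [y [z [Uy Uz ->]]]; exists (y ^ s)%g, (z ^ s)%g; rewrite conjRg.
by split=> //; apply: IHk.
Qed.

Variables (K : fieldType).

Lemma mx_rep_commute d (a : S -> 'M[K]_d) y z :
  mx_rep a -> a y *m a z = a z *m a y -> a [~ y, z]%g = 1%:M.
Proof.
move=> aP yz; have : a (y * z)%g = a (z * y)%g *m a [~ y, z]%g.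
  by rewrite -(mx_repM aP) -commgC.
rewrite !(mx_repM aP) yz -!(mx_repM aP) => /(congr1 (mulmx (a (z * y)^-1%g))).
by rewrite -!(mx_repM aP) mulVg mulKg mx_rep1.
Qed.

Lemma iter_commutator_mono d (a : S -> 'M[K]_d) (U : S -> Prop) k k' : mx_rep a ->
    (k <= k')%N -> (forall x, iter_commutator U k x -> a x = 1%:M) ->
  forall x, iter_commutator U k' x -> a x = 1%:M.
Proof.
move=> aP le_kk' Ua; rewrite -(subnK le_kk'); elim: (k' - k)%N => // j IHj x.
move=> [y [z [/IHj y1 /IHj z1 ->]]]; apply: mx_rep_commute => //.
by rewrite y1 z1.
Qed.

Lemma stablemxX d (V A : 'M[K]_d) n : stablemx V A -> stablemx V (A ^+ n).
Proof.
move=> stA; elim: n => [|n IHn]; first by rewrite expr0 mulmx1.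
by rewrite exprS -mulmxE mulmxA (submx_trans (submxMr _ stA)).
Qed.

Lemma sub_mxX d (V A : 'M[K]_d) n :
  stablemx V A -> sub_mx V (A ^+ n) = sub_mx V A ^+ n.
Proof.
move=> stA; elim: n => [|n IHn]; first by rewrite !expr0 sub_mx1.
by rewrite !exprS -!mulmxE sub_mxM ?IHn //; apply: stablemxX.
Qed.

Lemma quo_mxX d (V A : 'M[K]_d) n :
  stablemx V A -> quo_mx V (A ^+ n) = quo_mx V A ^+ n.
Proof.
move=> stA; elim: n => [|n IHn]; first by rewrite !expr0 quo_mx1.
by rewrite !exprS -!mulmxE quo_mxM ?IHn //; apply: stablemxX.
Qed.

Lemma stablemxB1 d (V A : 'M[K]_d) : stablemx V A -> stablemx V (A - 1).
Proof. by move=> stA; rewrite mulmxBr mulmx1 addmx_sub ?eqmx_opp. Qed.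

Lemma sub_mxB1 d (V A : 'M[K]_d) : sub_mx V (A - 1) = sub_mx V A - 1.
Proof. by rewrite /sub_mx mulmxBr mulmxBl mulmx1 row_baseK. Qed.

Lemma quo_mxB1 d (V A : 'M[K]_d) : quo_mx V (A - 1) = quo_mx V A - 1.
Proof. by rewrite /quo_mx mulmxBr mulmxBl mulmx1 col_baseK. Qed.

Lemma sub_quo_unipotent d (V A : 'M[K]_d) n k :
    stablemx V A -> (A ^+ n - 1) ^+ k = 0 ->
  (sub_mx V A ^+ n - 1) ^+ k = 0 /\ (quo_mx V A ^+ n - 1) ^+ k = 0.
Proof.
move=> stA Ank; have stAn := stablemxX n stA; have stB := stablemxB1 stAn.
rewrite -sub_mxX // -sub_mxB1 -sub_mxX // Ank -quo_mxX // -quo_mxB1 -quo_mxX // Ank.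
by rewrite /sub_mx /quo_mx !mulmx0 !mul0mx.
Qed.

Definition unipotent_at d (a : S -> 'M[K]_d) (x : S) : Prop :=
  exists k, (a x - 1) ^+ k = 0.

(** Unipotent elements act trivially on the factors of a composition series of
    the representation; those that act trivially on a subspace and on the
    quotient by it commute with each other. *)
Lemma iter_commutator_trivial d (a : S -> 'M[K]_d) : [pchar K] =i pred0 ->
    mx_rep a -> (forall x, quasi_unipotent (a x)) ->
  exists k, forall x, iter_commutator (unipotent_at a) k x -> a x = 1%:M.
Proof.
move=> K0; have [m] := ubnP d; elim: m d a => // m IHm d a lt_dm aP aQ.
have [|] := pselect (forall x, unipotent_at a x -> a x = 1%:M).
  by move=> a1; exists 0%N.
move=> /existsNP[g /not_implyP[[k gk] /eqP g_n1]].
have [V [stV V_n0 Vnfull]] := unipotent_reducible K0 aP aQ gk g_n1.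
have lt1 : (\rank V < m)%N.
  by rewrite -ltnS (leq_trans _ lt_dm) // ltnS ltn_neqAle rank_leq_col andbT.
have lt2 : (\rank (cokermx V) < m)%N.
  rewrite -ltnS (leq_trans _ lt_dm) // ltnS mxrank_coker ltn_subrL lt0n mxrank_eq0 V_n0.
  by apply: leq_trans (rank_leq_row V); rewrite lt0n mxrank_eq0.
have subP := sub_rep aP stV; have quoP := quo_rep aP stV.
have [k1 Hk1] : exists k, forall x,
    iter_commutator (unipotent_at (fun x => sub_mx V (a x))) k x ->
    sub_mx V (a x) = 1%:M.
  apply: IHm => // x; have [n [j [n_gt0 /(sub_quo_unipotent (stV x))[Vnj _]]]] := aQ x.
  by exists n, j.
have [k2 Hk2] : exists k, forall x,
    iter_commutator (unipotent_at (fun x => quo_mx V (a x))) k x ->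
    quo_mx V (a x) = 1%:M.
  apply: IHm => // x; have [n [j [n_gt0 /(sub_quo_unipotent (stV x))[_ Vnj]]]] := aQ x.
  by exists n, j.
have unip x : unipotent_at a x ->
    unipotent_at (fun x => sub_mx V (a x)) x /\
    unipotent_at (fun x => quo_mx V (a x)) x.
  move=> [j]; rewrite -[a x]expr1 => /(sub_quo_unipotent (stV x))[Vj Vj'].
  by split; exists j.
exists (maxn k1 k2).+1 => _ [y [z [Uy Uz ->]]]; apply: mx_rep_commute => //.
have triv x : iter_commutator (unipotent_at a) (maxn k1 k2) x ->
    row_base V *m (a x - 1) = 0 /\ (a x - 1 <= row_base V)%MS.
  move=> Ux; split.
    rewrite sub_mxE; last exact: stablemxB1.
    rewrite sub_mxB1 (iter_commutator_mono subP (leq_maxl k1 k2) Hk1) ?subrr ?mul0mx //.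
    by apply: iter_commutator_sub Ux => u /unip[].
  rewrite eq_row_base -mulmx_coker0 quo_mxE; last exact: stablemxB1.
  rewrite quo_mxB1 (iter_commutator_mono quoP (leq_maxr k1 k2) Hk2) ?subrr ?mulmx0 //.
  by apply: iter_commutator_sub Ux => u /unip[].
have [Vy /submxP[Dy Ey]] := triv y Uy; have [Vz /submxP[Dz Ez]] := triv z Uz.
have yz : (a y - 1) *m (a z - 1) = 0 by rewrite Ey -mulmxA Vz mulmx0.
have zy : (a z - 1) *m (a y - 1) = 0 by rewrite Ez -mulmxA Vy mulmx0.
have Dy1 := subrK 1 (a y); have Dz1 := subrK 1 (a z).
move: (a y - 1) (a z - 1) yz zy Dy1 Dz1 => Y Z YZ ZY <- <-.
by rewrite !(mulmxDl, mulmxDr) YZ ZY !mulmx1 !mul1mx !add0r !addrA [Z + Y]addrC.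
Qed.

End IteratedCommutators.

(** If [s] is a generator that occurs neither first nor last in the reduced word
    of [x], then the words [x * (s^-1 * x * s)] and [(s^-1 * x * s) * x] are reduced
    as written, and they have different first letters. *)
Lemma free_noncommute (J : choiceType) (x : free_group J) :
    (forall i j : J, exists k, (k != i) && (k != j)) -> x != 1%g ->
  exists s, ~ commute x (x ^ s)%g.
Proof.
move=> third; rewrite free_eq1; case Dx: (word_of x) => [//|b t] _.
have red_x : reduced (b :: t) by rewrite -Dx free_group_reduced.
have [k /andP[ne_kb ne_kl]] := third b.1 (last b t).1.
pose c := (k, false); pose c' := (k, true); exists (free_letter c).
have ne_fst (e f : J * bool) : e.1 != f.1 -> f != flip_letter e.
  by apply: contraNneq => ->.
have Dxs : word_of (x ^ free_letter c)%g = c' :: rcons (b :: t) c.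
  have red_xc : reduced ((b :: t) ++ [:: c]).
    by rewrite cat_cons reduced_cat_cons red_x /= ne_fst //= eq_sym.
  have Dxc : word_of (x * free_letter c)%g = (b :: t) ++ [:: c].
    by rewrite word_ofM_reduced Dx.
  rewrite conjgE free_letterV word_of_letterM Dxc -cats1 /= ifN //.
  by rewrite ne_fst.
have red1 : reduced (word_of x ++ word_of (x ^ free_letter c)%g).
  rewrite Dx Dxs cat_cons reduced_cat_cons red_x -Dxs free_group_reduced /=.
  by rewrite ne_fst //= eq_sym.
have red2 : reduced (word_of (x ^ free_letter c)%g ++ word_of x).
  rewrite Dx Dxs cat_cons reduced_cat_cons red_x -[_ :: rcons _ _]Dxs.
  rewrite free_group_reduced /=.
  by rewrite last_rcons ne_fst.
move=> /(congr1 (@word_of J)).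
rewrite (word_ofM_reduced red1) (word_ofM_reduced red2) Dxs Dx => -[Dbc].
by move: ne_kb; rewrite Dbc eqxx.
Qed.

Lemma free_gen_torsion_free (J : choiceType) (i : J) n :
  (0 < n)%N -> (free_gen i ^+ n)%g != 1%g.
Proof.
move=> n_gt0; have Dw m : word_of (free_gen i ^+ m)%g = nseq m (i, false).
  elim: m => // m IHm; rewrite expgS -[free_gen i]/(free_letter (i, false)).
  by rewrite word_of_letterM IHm; case: m {IHm} => //= m; rewrite xpair_eqE andbF.
by rewrite free_eq1 Dw; case: n n_gt0.
Qed.

(** In positive characteristic a quasi-unipotent matrix has finite order. In
    characteristic 0, a power [x] of a generator is unipotent, and so are its
    conjugates; the commutators [~ x, x ^ s], for suitable [s] at each step, never
    become trivial. *)
Lemma free_not_quasi_unipotent (J : choiceType) (i0 : J) (K : fieldType) d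
    (a : free_group J -> 'M[K]_d) :
    (forall i j : J, exists k, (k != i) && (k != j)) ->
    mx_rep a -> (forall x, a x = 1%:M -> x = 1%g) ->
  ~ (forall x, quasi_unipotent (a x)).
Proof.
move=> third aP a_inj aQ.
have [[p pK]|no_p] := pselect (exists p, p \in [pchar K]).
  have [n n_gt0] := quasi_unipotent_pchar pK (aQ (free_gen i0)).
  rewrite -mx_repX // => /a_inj/eqP; apply/negP.
  exact: free_gen_torsion_free.
have K0 : [pchar K] =i pred0.
  by move=> p; rewrite inE; apply/negbTE/negP => pK; apply: no_p; exists p.
have [k trivk] := iter_commutator_trivial K0 aP aQ.
suff [x /trivk/a_inj x1 /eqP[]//] :
  exists2 x, iter_commutator (unipotent_at a) k x & x != 1%g.
elim: k {trivk} => [|k [x Ux x_n1]].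
  have [n [j [n_gt0 nj]]] := aQ (free_gen i0); exists (free_gen i0 ^+ n)%g.
    by exists j; rewrite mx_repX.
  exact: free_gen_torsion_free.
have [s xs] := free_noncommute third x_n1.
exists [~ x, x ^ s]%g; last by apply/eqP => /eqP/commgP.
exists x, (x ^ s)%g; split=> //; apply: iter_commutatorJ Ux => y [j yj].
exists j; have -> : a (y ^ s)%g - 1 = a s^-1%g *m (a y - 1) *m a s.
  rewrite mulmxBr mulmxBl mulmx1 -!(mx_repM aP) mulVg (mx_rep1 aP).
  by rewrite -mulgA.
have conjX m : (a s^-1%g *m (a y - 1) *m a s) ^+ m = a s^-1%g *m (a y - 1) ^+ m *m a s.
  elim: m => [|m IHm].
    by rewrite !expr0 mulmx1 -(mx_repM aP) mulVg (mx_rep1 aP).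
  rewrite !exprS IHm -!mulmxE !mulmxA -(mulmxA _ (a s) (a s^-1%g)).
  by rewrite -(mx_repM aP) mulgV (mx_rep1 aP) mulmx1.
by rewrite conjX yj mulmx0 mul0mx.
Qed.

Local Close Scope ring_scope.
Local Open Scope group_scope.

(** * Nonlinearity *)

Section FormanekProcesi.
Variable I : choiceType.
Local Notation F := (free_group (option I)).
Local Notation G := (free_group I).
Local Notation iota := (free_map (@Some I)).
Local Notation z := (free_gen (None : option I)).

Definition transvection_fun (g : G) : {multiplicative F -> F} :=
  free_hom (fun j => if j is Some i then free_gen (Some i) else (iota g)^-1 * z).

Lemma transvection_fix g x : transvection_fun g (iota x) = iota x.
Proof.
rewrite -[LHS]/((transvection_fun g \o iota) x).
by apply: eq_free_hom => i; rewrite /= free_map_gen free_hom_gen.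
Qed.

Fact transvection1 : transvection_fun 1 =1 id.
Proof.
by apply: eq_free_end_id => -[i|]; rewrite free_hom_gen // hom1 invg1 mul1g.
Qed.

Fact transvectionM g h x :
  transvection_fun (g * h) x = transvection_fun g (transvection_fun h x).
Proof.
rewrite -[RHS]/((transvection_fun g \o transvection_fun h) x).
apply: eq_free_hom => -[i|] /=; rewrite !free_hom_gen //.
by rewrite !gmulfM homV transvection_fix free_hom_gen invgM mulgA.
Qed.

Definition transvection : {multiplicative G -> aut F} :=
  hom_aut transvection1 transvectionM.

Definition twist_fun (e : bool) : {multiplicative F -> F} :=
  free_hom (fun j => if j is Some i then
    (if e then free_gen (Some i) ^ z^-1 else free_gen (Some i) ^ z) else z).

Fact twistK : cancel (twist_fun true) (twist_fun false).
Proof.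
apply: (eq_free_end_id (f := twist_fun false \o twist_fun true)) => -[i|] /=;
  rewrite !free_hom_gen ?homJ ?homV ?free_hom_gen //.
by rewrite -conjgM mulgV conjg1.
Qed.

Fact twistKV : cancel (twist_fun false) (twist_fun true).
Proof.
apply: (eq_free_end_id (f := twist_fun true \o twist_fun false)) => -[i|] /=;
  rewrite !free_hom_gen ?homJ ?homV ?free_hom_gen //.
by rewrite -conjgM mulVg conjg1.
Qed.

Definition twist : aut F := mkaut twistK twistKV.

Lemma twist_map x : twist (iota x) = iota x ^ z^-1.
Proof.
rewrite -[LHS]/((twist \o iota) x) -[RHS]/((mkhom (inn_homM z) \o iota) x).
by apply: eq_free_hom => i; rewrite /= free_map_gen [LHS]free_hom_gen.
Qed.

Lemma transvection_inn g h :
  transvection h * inn (iota g) = inn (iota g) * transvection h.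
Proof.
apply: (mulIg (transvection h)^-1); rewrite inn_conj mulgK.
by apply: (congr1 inn); exact: transvection_fix.
Qed.

(** Conjugating by the twist turns a transvection into its product with an inner
    automorphism that commutes with all transvections. *)
Lemma twist_transvection g :
  twist * transvection g = inn (iota g) * transvection g * twist.
Proof.
have fix_x i : transvection g (free_gen (Some i)) = free_gen (Some i).
  exact: free_hom_gen.
have on_z : transvection g z = (iota g)^-1 * z by apply: free_hom_gen.
have tw_x i : twist (free_gen (Some i)) = free_gen (Some i) ^ z^-1.
  exact: free_hom_gen.
have tw_z : twist z = z by apply: free_hom_gen.
apply: aut_free_eq => -[i|]; rewrite !autM.
  rewrite fix_x tw_x aut_homJ aut_homV fix_x on_z innE.
  by rewrite !conjgE !invgM !invgK !mulgA !mulgV !mul1g ?mulgVK ?mulgK.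
rewrite on_z tw_z on_z aut_homM aut_homV twist_map tw_z innE.
by rewrite !conjgE !invgM !invgK !mulgA mulgV mul1g mulgVK.
Qed.

End FormanekProcesi.

Arguments transvection {I}.

Lemma contains_fin_free (J : choiceType) (T : finType) (p q : J) :
  p != q -> contains (free_group J) (free_group T).
Proof.
move=> ne_pq; apply: (@contains_trans _ (free_group 'I_#|T|)).
  exact: contains_free ne_pq.
by exists (free_map enum_rank); apply/free_map_inj/enum_rank_inj.
Qed.

Lemma third_ord (i j : 'I_3) : exists k : 'I_3, (k != i) && (k != j).
Proof.
have [k kP|none] := pickP [pred k : 'I_3 | (k != i) && (k != j)]; first by exists k.
have /subset_leq_card : 'I_3 \subset pred2 i j.
  apply/fintype.subsetP => k _; have := none k; rewrite !inE /= => /negbT.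
  by rewrite negb_and !negbK.
by rewrite card_ord card2; case: (i != j).
Qed.

(** The free group on three generators, needed for [free_noncommute], is sent into
    the commutator subgroup of the free group on [I], where determinants are
    trivial; its elements then act by quasi-unipotent matrices. *)
Lemma aut_free_nonlinear (I : choiceType) (p q : I) (H : groupType) :
  p != q -> contains H (aut (free_group (option I))) -> ~ linear_group H.
Proof.
move=> ne_pq cH [d [K [_ cGL]]]; have [rho rho_inj] := contains_trans cGL cH.
have [E E_inj] := @contains_fin_free I ('I_3 * bool)%type p q ne_pq.
pose e : {multiplicative free_group 'I_3 -> free_group I} :=
  E \o free_hom (@gen_commutator 'I_3).
have e_inj : injective e by apply: inj_comp => //; exact: gen_commutator_inj.
have e_triv (L : fieldType) x : char_trivial L (e x).
  move=> chi chi1 chiM; move: x; apply: free_ind => [|a x IHx]; first by rewrite hom1.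
  rewrite gmulfM chiM IHx GRing.mulr1 -letter_val_gen.
  have chiV y : (chi y^-1%g * chi y)%R = 1%R by rewrite -chiM mulVg.
  have chi_c i : chi (e (free_gen i)) = 1%R.
    rewrite /= [free_hom _ _]free_hom_gen homR commgEl conjgE !chiM.
    by rewrite GRing.mulrA GRing.mulrACA !chiV GRing.mulr1.
  rewrite /letter_val; case: a.2; rewrite ?homV ?chi_c //.
  by have := chiV (e (free_gen a.1)); rewrite chi_c GRing.mulr1.
pose b (g : free_group I) : 'M[K]_d := rho (transvection g).
pose a x : 'M[K]_d := rho (inn (free_map (@Some I) (e x))).
have bP : mx_rep b by split=> [|x y]; rewrite /b ?hom1 ?gmulfM.
have aP : mx_rep a by split=> [|x y]; rewrite /a ?hom1 ?gmulfM.
apply: (free_not_quasi_unipotent (ord0 : 'I_3) third_ord aP) => [x ax1|x].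
  apply: e_inj; rewrite hom1; apply: (@free_map_inj _ _ (@Some I)).
    by move=> ? ? [].
  rewrite hom1; apply: (@inn_free_inj _ None (Some p)) => //.
  by rewrite hom1; apply: rho_inj; rewrite hom1; apply/val_inj.
apply: (@conj_mul_quasi_unipotent _ _ _ _ (rho (twist I)) b (e x)) => //.
- exact: Defs.GL_unitmx.
- exact: Defs.GL_unitmx.
- move=> g; rewrite /a /b; have := congr1 rho (transvection_inn (e x) g).
  by rewrite !gmulfM => /(congr1 (@GL_mx d K)) /= ->.
have := congr1 rho (twist_transvection (e x)).
rewrite !gmulfM => /(congr1 (@GL_mx d K)) /= ->.
by rewrite mulmxK // Defs.GL_unitmx.
Qed.

Theorem proposition4 (R : realType) (n : nat) (n_gt0 : (0 < n)%N)
    (H : groupType) (H_AutFn : contains H (aut (free_group 'I_n))) :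
  [/\ (forall s : nat, (0 < s)%N -> (s <= n)%N ->
         contains H (aut (free_group 'I_s))),
      ((2 <= n)%N ->
         (forall m : nat, (0 < m)%N -> contains H (free_group 'I_m))
         /\ ~ amenable R H),
      ((3 <= n)%N -> ~ linear_group H)
    & ((3 <= n)%N -> contains H (braid_group n))].
Proof.
split.
- move=> s _ le_sn; apply: contains_trans H_AutFn _.
  apply: (contains_aut_free (h := widen_ord le_sn)).
  by move=> i j /(congr1 val) /= /val_inj.
- case: n n_gt0 H_AutFn => [|[|n]] // _ H_AutFn _.
  have ne01 : ord0 != ord_max :> 'I_n.+2 by [].
  have H_free : contains H (free_group 'I_n.+2).
    apply: contains_trans H_AutFn _.
    by exists inn; exact: (inn_free_inj ne01).
  split=> [m _|]; first exact: contains_trans H_free (contains_free m ne01).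
  by have [f f_inj] := H_free; exact: (free_nonamenable ne01 f_inj).
- move=> le_3n; have ne01 : ord0 != ord_max :> 'I_2 by [].
  apply: (aut_free_nonlinear ne01); apply: contains_trans H_AutFn _.
  pose h (o : option 'I_2) : 'I_n :=
    widen_ord le_3n (if o is Some i then widen_ord (leqnSn 2) i else ord_max).
  apply: (contains_aut_free (h := h)).
  move=> [i|] [j|] /(congr1 val) //= Eij.
  + by congr Some; apply: val_inj.
  + by move: (ltn_ord i); rewrite Eij.
  by move: (ltn_ord j); rewrite -Eij.
- case: n n_gt0 H_AutFn => // n _ H_AutFn _.
  exact: contains_trans H_AutFn (contains_braid n).
Qed.
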